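(* Let $K$ be a field and let $k$ be a subfield of $K$ which is a pseudo-algebraically closed (PAC) field that is not separably closed and which is relatively algebraically closed in $K$. Then for every $n\ge1$, the complete theory of $K$ (in the language of rings) has the $n$-independence property.
   Context: A field $k$ is pseudo-algebraically closed (PAC) if every absolutely irreducible variety defined over $k$ has a $k$-rational point. $k$ is relatively algebraically closed in $K$ if every element of $K$ algebraic over $k$ lies in $k$. A formula $\psi(\bar y_0,\dots,\bar y_{n-1};\bar x)$ has the $n$-independence property (IP$_n$) if there exist, in some model of the theory, parameters $(\bar a^j_i:i\in\omega,j<n)$ and $(\bar b_I:I\subseteq\omega^n)$ with $\psi(\bar a^0_{i_0},\dots,\bar a^{n-1}_{i_{n-1}};\bar b_I)$ true iff $(i_0,\dots,i_{n-1})\in I$; a theory has IP$_n$ if some formula does. *)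

(* Defs.v *)
From HB Require Import structures.
From mathcomp Require Import all_boot all_order all_algebra all_field.
From mathcomp Require Import mpoly.

Set Implicit Arguments.
Unset Strict Implicit.
Unset Printing Implicit Defensive.

Import GRing.Theory.
Local Open Scope ring_scope.

Definition ideal_generated (R : comNzRingType) (F : seq R) (p : R) : Prop :=
  exists c : 'I_(size F) -> R, p = \sum_(j < size F) c j * F`_j.

Definition prime_ideal (R : comNzRingType) (P : R -> Prop) : Prop :=
  ~ P 1 /\ forall p q, P (p * q) -> P p \/ P q.

Definition algebraic_closure (k : fieldType) (L : closedFieldType)
    (i : {rmorphism k -> L}) : Prop :=
  forall x : L, algebraicOver i x.

(* The affine k-variety Spec k[X_1, .., X_m]/(F) is absolutely irreducible when
   F still generates a prime ideal after base change to the algebraic closure.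
   Primality is required of the ideal (F) itself, not of its radical: over an
   imperfect k, the equation X^p = a with a not a p-th power cuts out a single
   point of the algebraic closure, but it does not define an absolutely
   irreducible variety over k.  Quantifying over all algebraic closures is
   harmless, since they are pairwise k-isomorphic. *)
Definition absolutely_irreducible (k : fieldType) (m : nat)
    (F : seq {mpoly k[m]}) : Prop :=
  forall (L : closedFieldType) (i : {rmorphism k -> L}),
    algebraic_closure i ->
    prime_ideal (ideal_generated [seq map_mpoly i f | f <- F]).

Definition rational_point (k : fieldType) (m : nat)
    (F : seq {mpoly k[m]}) (x : 'I_m -> k) : Prop :=
  forall f, f \in F -> f.@[x] = 0.

(* Affine varieties suffice: every variety over k has a nonempty affine open
   subvariety, and it is absolutely irreducible when the whole variety is. *)
Definition pseudo_algebraically_closed (k : fieldType) : Prop :=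
  forall (m : nat) (F : seq {mpoly k[m]}),
    absolutely_irreducible F -> exists x : 'I_m -> k, rational_point F x.

Definition separably_closed (k : fieldType) : Prop :=
  forall L : fieldExtType k, separable 1 {:L} -> {:L}%VS = 1%VS.

Definition relatively_algebraically_closed (K : fieldType) (S : {pred K})
    (k : subFieldType S) : Prop :=
  forall x : K, algebraicOver (\val : k -> K) x -> x \in S.

(* [V] is the type of free variables.  Under a quantifier the variables are
   [option V], with [None] the bound one. *)
Inductive term (V : Type) : Type :=
  | Var of V
  | Zero
  | One
  | Opp of term V
  | Add of term V & term V
  | Mul of term V & term V.

Inductive formula (V : Type) : Type :=
  | Eq of term V & term V
  | False_
  | Imp of formula V & formula V
  | And of formula V & formula V
  | Or of formula V & formula V
  | Forall of formula (option V)
  | Exists of formula (option V).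

Definition sentence := formula Empty_set.

Record ring_structure := RingStructure {
  carrier :> Type;
  rs_zero : carrier;
  rs_one : carrier;
  rs_opp : carrier -> carrier;
  rs_add : carrier -> carrier -> carrier;
  rs_mul : carrier -> carrier -> carrier }.

Definition field_structure (K : fieldType) : ring_structure :=
  @RingStructure K 0 1 -%R +%R *%R.

Fixpoint eval (M : ring_structure) (V : Type) (e : V -> M) (t : term V) : M :=
  match t with
  | Var v => e v
  | Zero => rs_zero M
  | One => rs_one M
  | Opp t1 => rs_opp (eval e t1)
  | Add t1 t2 => rs_add (eval e t1) (eval e t2)
  | Mul t1 t2 => rs_mul (eval e t1) (eval e t2)
  end.

Definition extend (M V : Type) (e : V -> M) (a : M) (v : option V) : M :=
  if v is Some w then e w else a.

Fixpoint satisfies (M : ring_structure) (V : Type) (e : V -> M)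
    (f : formula V) : Prop :=
  match f with
  | Eq t1 t2 => eval e t1 = eval e t2
  | False_ => False
  | Imp f1 f2 => satisfies e f1 -> satisfies e f2
  | And f1 f2 => satisfies e f1 /\ satisfies e f2
  | Or f1 f2 => satisfies e f1 \/ satisfies e f2
  | Forall f1 => forall a : M, satisfies (extend e a) f1
  | Exists f1 => exists a : M, satisfies (extend e a) f1
  end.

Definition holds (M : ring_structure) (s : sentence) : Prop :=
  satisfies (fun v : Empty_set => match v return M with end) s.

Definition theory := sentence -> Prop.

Definition complete_theory (M : ring_structure) : theory := holds M.

Definition model (T : theory) (M : ring_structure) : Prop :=
  forall s, T s -> holds M s.

(* The variables of psi(y_0, .., y_(n-1); x), where the tuple y_j has length
   [l j] and the tuple x has length [d]. *)
Definition block_var (n : nat) (l : 'I_n -> nat) (d : nat) : Type :=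
  ({j : 'I_n & 'I_(l j)} + 'I_d)%type.

Definition block_assign (M : Type) (n : nat) (l : 'I_n -> nat) (d : nat)
    (y : forall j, 'I_(l j) -> M) (x : 'I_d -> M) (v : block_var l d) : M :=
  match v with
  | inl u => y (tag u) (tagged u)
  | inr t => x t
  end.

Definition formula_IP (T : theory) (n : nat) (l : 'I_n -> nat) (d : nat)
    (psi : formula (block_var l d)) : Prop :=
  exists2 M : ring_structure, model T M &
  exists (a : forall j : 'I_n, nat -> 'I_(l j) -> M)
         (b : ({ffun 'I_n -> nat} -> Prop) -> 'I_d -> M),
  forall (I : {ffun 'I_n -> nat} -> Prop) (i : {ffun 'I_n -> nat}),
    satisfies (block_assign (fun j => a j (i j)) (b I)) psi <-> I i.

Definition IP (n : nat) (T : theory) : Prop :=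
  exists (l : 'I_n -> nat) (d : nat) (psi : formula (block_var l d)),
    formula_IP T psi.

(* Main.v *)
(* Since [k] is not separably closed, there are a finite separable extension
   [k' = k[X]/g], a prime [l] and [a] in [k'] such that [a] is not an [l]-th
   power in [k'] (Kummer, [l] prime to the characteristic) or not of the form
   [h ^ l - h] (Artin-Schreier, [l] the characteristic).  Let [theta] be the
   class of [X] and [Phi h = h ^ l], respectively [h ^ l - h].  For distinct
   [e_j] in [k] with [e_i - e_j] not a difference of conjugates of [theta], the
   equations [(t + theta + e_j) a h_j ^ l = 1], respectively
   [(t + theta + e_j) (h_j ^ l - h_j - a) = 1], and their untwisted versions
   ([a] replaced by [1], respectively [0]) can be mixed freely: with [t] in [k]
   and [h_j] in [k'] as unknowns, they become by restriction of scalars a curve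
   over [k].  Over the algebraic closure it is a fibre product of cyclic covers
   of the [t]-line which are independent because their branch points
   [- theta_s - e_j] are distinct, so it is absolutely irreducible and has a
   [k]-point.  Hence [exists h, (t + theta + e_j) Phi(h) = 1] can be made true
   for exactly the [j] in a given set; it stays false in [K] for the other [j]
   because [k] is relatively algebraically closed in [K].  Taking for the [e_j]
   the powers [eta ^ (i_0 + i_1 R + .. + i_(n-1) R ^ (n-1))], which are products
   of [n] factors [eta ^ (i_j R ^ j)], gives every finite [n]-dimensional
   pattern in [K], and an ultrapower of [K] realises all infinite ones. *)

Require Import Defs.
From HB Require Import structures.
From mathcomp Require Import all_boot all_order all_fingroup all_algebra.
From mathcomp Require Import all_solvable all_field.
From mathcomp Require Import mpoly ring.
From mathcomp Require filter.
From Stdlib Require Import ClassicalEpsilon FunctionalExtensionality.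
From Stdlib Require Import PropExtensionality ProofIrrelevance.

Set Implicit Arguments.
Unset Strict Implicit.
Unset Printing Implicit Defensive.

Import GRing.Theory.
Local Open Scope ring_scope.

(** * Ultrapowers *)

(** Absolute irreducibility concerns the ideal generated by the equations and not its radical, so an
    irreducible solution set is not enough: the equations must generate the whole kernel of a map
    into a field. The factor [t + theta + e_j] makes this accessible. Each equation exhibits an
    inverse of its own factor, so its leading coefficient is a unit modulo the ideal and
    pseudo-division by it loses nothing. In the Artin-Schreier case the factor does more: it gives
    each function [1 / (t + theta_s + e_j)] a simple pole at a point of its own. With
    [t + theta_s + e_j] in its place, two of the functions would differ by a constant, which is some
    [c ^ l - c] over an algebraically closed field, and the covers would be dependent.

    Elements of the compositum of [k'] and [K] are handled as polynomials over [K] modulo [g].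
    Solvability is then a divisibility in [K[X]] with bounded degrees, which the language of rings
    can express with the coefficients of [g] as parameters. *)

Record ultrafilter_on_nat (U : (nat -> Prop) -> Prop) : Prop := {
  ultra_eventually : forall N, U (fun i => (N <= i)%N);
  ultra_and : forall A B : nat -> Prop, U A -> U B -> U (fun i => A i /\ B i);
  ultra_mono : forall A B : nat -> Prop, (forall i, A i -> B i) -> U A -> U B;
  ultra_not : forall A : nat -> Prop, U (fun i => ~ A i) <-> ~ U A }.

Lemma ultrafilter_on_nat_exists : exists U, ultrafilter_on_nat U.
Proof.
have [U [UU sU]] := filter.ultraFilterLemma filter.eventually_filter.
have FU : filter.Filter U by exact: filter.filter_filter.
exists U; split=> [N|A B|A B sAB|A].
- by apply: sU; exists N.
- exact: (@filter.filterI _ _ FU).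
- exact: (@filter.filterS _ _ FU).
- split=> [UnA UA|nUA]; last by case: (filter.in_ultra_setVsetC A UU).
  apply: (@filter.filter_not_empty _ U _).
  apply: (@filter.filterS _ _ FU _ _ _ (@filter.filterI _ _ FU _ _ UA UnA)).
  by move=> i [].
Qed.

Lemma eq_satisfies (M : ring_structure) (V : Type) (e1 e2 : V -> M)
    (f : formula V) :
  e1 =1 e2 -> satisfies e1 f -> satisfies e2 f.
Proof. by move=> /functional_extensionality ->. Qed.

Section Ultrapower.

Variables (U : (nat -> Prop) -> Prop) (hU : ultrafilter_on_nat U).
Variable M : ring_structure.

Let eqU (f g : nat -> M) := U (fun i => f i = g i).

Let U_all (A : nat -> Prop) : (forall i, A i) -> U A.
Proof. by move=> allA; apply: ultra_mono (ultra_eventually hU 0). Qed.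

Let U_iff (A B : nat -> Prop) : U (fun i => A i <-> B i) -> U A <-> U B.
Proof.
move=> UAB; split=> UX; apply: (ultra_mono hU _ (ultra_and hU UAB UX)).
  by move=> i [[]]; auto.
by move=> i [[]]; auto.
Qed.

(** The quotient by [eqU] is formed by choosing representatives: equivalent sequences have equal
    predicates [eqU f], by extensionality, so [epsilon] returns the same sequence for both. *)
Definition canon (f : nat -> M) : nat -> M :=
  epsilon (inhabits (fun=> rs_zero M)) (eqU f).

Lemma canon_eq f : eqU f (canon f).
Proof. by apply: epsilon_spec; exists f; apply: U_all. Qed.

Lemma eq_canon f g : eqU f g -> canon f = canon g.
Proof.
move=> fg; rewrite /canon; congr (epsilon _ _).
apply: functional_extensionality => h; apply: propositional_extensionality.
by apply: U_iff; apply: (ultra_mono hU _ fg) => i ->.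
Qed.

Definition ultraset := {f : nat -> M | canon f = f}.

Definition cls (f : nat -> M) : ultraset :=
  exist _ (canon f) (esym (eq_canon (canon_eq f))).

Lemma cls_eq f g : cls f = cls g <-> eqU f g.
Proof.
split=> [/(congr1 sval)/= fg|fg].
  have := ultra_and hU (canon_eq f) (canon_eq g); rewrite fg.
  by apply: ultra_mono hU _ _ _ => i [-> ->].
by apply: eq_sig_hprop => [? ? ?|/=]; [apply: proof_irrelevance|apply:
  eq_canon].
Qed.

Lemma cls_sval (x : ultraset) : cls (sval x) = x.
Proof. by apply: eq_sig_hprop => [? ? ?|]; [apply: proof_irrelevance|case: x].
  Qed.

Lemma sval_cls f : U (fun i => sval (cls f) i = f i).
Proof. by apply: (ultra_mono hU _ (canon_eq f)) => i /= <-. Qed.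

Definition ultrapower := @RingStructure ultraset
  (cls (fun=> rs_zero M)) (cls (fun=> rs_one M))
  (fun x => cls (fun i => rs_opp (sval x i)))
  (fun x y => cls (fun i => rs_add (sval x i) (sval y i)))
  (fun x y => cls (fun i => rs_mul (sval x i) (sval y i))).

Lemma eval_ultrapower (V : Type) (e : V -> nat -> M) (t : term V) :
  eval (M := ultrapower) (fun v => cls (e v)) t
  = cls (fun i => eval (fun v => e v i) t).
Proof.
pose ev t i := eval (fun v => e v i) t.
elim: t => //= [t ->|t1 -> t2 ->|t1 -> t2 ->]; apply/cls_eq.
- by apply: (ultra_mono hU _ (sval_cls (ev t))) => i /= ->.
- apply: (ultra_mono hU _ (ultra_and hU (sval_cls (ev t1)) (sval_cls (ev t2)))).
  by move=> i /= [-> ->].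
- apply: (ultra_mono hU _ (ultra_and hU (sval_cls (ev t1)) (sval_cls (ev t2)))).
  by move=> i /= [-> ->].
Qed.

Let extend_cls (V : Type) (e : V -> nat -> M) (a : nat -> M) :
  extend (M := ultrapower) (fun v => cls (e v)) (cls a)
  = (fun v => cls (fun i => extend (fun w => e w i) (a i) v)).
Proof. by apply: functional_extensionality => -[]. Qed.

Theorem los (V : Type) (e : V -> nat -> M) (phi : formula V) :
  satisfies (M := ultrapower) (fun v => cls (e v)) phi
  <-> U (fun i => satisfies (fun v => e v i) phi).
Proof.
elim: phi e => /= {V} [V t1 t2|V|V f1 IH1 f2 IH2|V f1 IH1 f2 IH2|V f1 IH1 f2
  IH2|V f IH|V f IH] e.
- by rewrite !eval_ultrapower; apply: cls_eq.
- by split=> // UF; apply: (iffLR (ultra_not hU (fun=> False))) UF; apply: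
  U_all => i [].
- rewrite IH1 IH2; split=> [H12|U12 U1].
    case: (classic (U (fun i => satisfies (fun v => e v i) f1))).
      by move/H12; apply: (ultra_mono hU).
    by move/(ultra_not hU); apply: (ultra_mono hU) => i nf /nf.
  by apply: (ultra_mono hU _ (ultra_and hU U12 U1)) => i [h /h].
- rewrite IH1 IH2; split=> [[U1 U2]|U12]; first exact: ultra_and.
  by split; apply: (ultra_mono hU _ U12) => i [].
- rewrite IH1 IH2; split=> [[] U1|U12].
  + by apply: (ultra_mono hU _ U1) => i; left.
  + by apply: (ultra_mono hU _ U1) => i; right.
  case: (classic (U (fun i => satisfies (fun v => e v i) f1))); first by left.
  move/(ultra_not hU) => n1; right.
  by apply: (ultra_mono hU _ (ultra_and hU U12 n1)) => i [[]].
- split=> [Hall|Uall a].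
    apply: NNPP => /(ultra_not hU) Un.
    (* A counterexample is chosen at each index that has one, and an arbitrary value elsewhere; the
       class of this sequence refutes the universal statement in the ultrapower. *)
    have Hex i : exists a, ~ satisfies (fun v => e v i) (Forall f) ->
        ~ satisfies (extend (fun v => e v i) a) f.
      case: (classic (exists a, ~ satisfies (extend (fun v => e v i) a) f)).
        by case=> a na; exists a.
      move=> nex; exists (rs_zero M) => nall; case: nall => a /=.
      by apply: NNPP => na; apply: nex; exists a.
    pose a i := sval (constructive_indefinite_description _ (Hex i)).
    have := Hall (cls a); rewrite extend_cls IH => Ua.
    apply: (iffLR (ultra_not hU (fun=> False))); first by apply: U_all => i [].
    apply: (ultra_mono hU _ (ultra_and hU Ua Un)) => i [sa nall].
    move: sa; have := svalP (constructive_indefinite_description _ (Hex i))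
      nall.
    by rewrite -/(a i) => na sa; apply: na; move: sa; apply: eq_satisfies =>
      -[].
  rewrite -(cls_sval a) extend_cls IH.
  apply: (ultra_mono hU _ Uall) => i /(_ (sval a i));
  by apply: eq_satisfies => -[].
- split=> [[a]|Uex].
    rewrite -(cls_sval a) extend_cls IH; apply: (ultra_mono hU) => i sa.
    by exists (sval a i); move: sa; apply: eq_satisfies => -[].
  have Hex i : exists a, satisfies (fun v => e v i) (Exists f) ->
      satisfies (extend (fun v => e v i) a) f.
    case: (classic (exists a, satisfies (extend (fun v => e v i) a) f)).
      by case=> a sa; exists a.
    by move=> nex; exists (rs_zero M).
  pose a i := sval (constructive_indefinite_description _ (Hex i)).
  exists (cls a); rewrite extend_cls IH; apply: (ultra_mono hU _ Uex) => i sex.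
  have := svalP (constructive_indefinite_description _ (Hex i)) sex.
  by apply: eq_satisfies => -[].
Qed.

Lemma model_ultrapower : model (complete_theory M) ultrapower.
Proof.
move=> s sM; rewrite /holds.
have -> : (fun v : Empty_set => match v return ultrapower with end)
    = (fun v => cls (match v with end)) by apply: functional_extensionality.
apply/los; apply: U_all => i; move: sM.
by apply: eq_satisfies.
Qed.

End Ultrapower.

(* Countably many coordinates suffice although there are uncountably many sets
   [I]: the [N]-th coordinate of [b I] only has to be right on the box
   [[0, N)^n]. *)
Lemma formula_IP_finite (M : ring_structure) (n : nat) (l : 'I_n -> nat)
    (d : nat) (psi : formula (block_var l d)) :
    (forall N : nat, exists (a : forall j : 'I_n, nat -> 'I_(l j) -> M)
       (b : ({ffun 'I_n -> nat} -> Prop) -> 'I_d -> M),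
       forall (I : {ffun 'I_n -> nat} -> Prop) (i : {ffun 'I_n -> nat}),
         (forall j, (i j < N)%N) ->
         satisfies (block_assign (fun j => a j (i j)) (b I)) psi <-> I i) ->
  formula_IP (complete_theory M) psi.
Proof.
move=> finM; have [U hU] := ultrafilter_on_nat_exists.
exists (ultrapower hU M); first exact: model_ultrapower.
pose a N := sval (constructive_indefinite_description _ (finM N)).
have aP N := svalP (constructive_indefinite_description _ (finM N)).
pose b N := sval (constructive_indefinite_description _ (aP N)).
have bP N := svalP (constructive_indefinite_description _ (aP N)).
exists (fun j m t => cls hU (fun N => a N j m t)).
exists (fun I t => cls hU (fun N => b N I t)) => I i.
pose e (v : block_var l d) N := block_assign (fun j => a N j (i j)) (b N I) v.
transitivity (satisfies (M := ultrapower hU M) (fun v => cls hU (e v)) psi).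
  suff -> : (fun v => cls hU (e v)) = block_assign
      (fun j t => cls hU (fun N => a N j (i j) t))
      (fun t => cls hU (fun N => b N I t)) by [].
  by apply: functional_extensionality => -[].
have Ularge : U (fun N => (satisfies (fun v => e v N) psi) <-> I i).
  (* The tuple [i] lies in the box of side [N] as soon as [N] exceeds its largest entry. *)
  apply: (ultra_mono hU _ (ultra_eventually hU (\max_j i j).+1)) => N ltN.
  suff -> : (fun v => e v N) = block_assign (fun j => a N j (i j)) (b N I).
    by apply: bP => j; apply: leq_ltn_trans ltN; apply: leq_bigmax.
  by apply: functional_extensionality.
rewrite los; split=> [Us|Ii].
  apply: NNPP => nI; apply: (iffLR (ultra_not hU (fun=> False))).
    by apply: (ultra_mono hU _ Us) => N _ [].
  by apply: (ultra_mono hU _ (ultra_and hU Us Ularge)) => N [s [/(_ s)]].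
by apply: (ultra_mono hU _ Ularge) => N [_ /(_ Ii)].
Qed.

(** * Prime ideals as kernels *)

Record ideal_pred (R : comNzRingType) (I : R -> Prop) : Prop := {
  ideal0 : I 0;
  idealD : forall p q, I p -> I q -> I (p + q);
  idealMl : forall p q, I q -> I (p * q) }.

Lemma ideal_generated_pred (R : comNzRingType) (F : seq R) :
  ideal_pred (ideal_generated F).
Proof.
split=> [|p q [c ->] [d ->]|p q [c ->]].
- by exists (fun=> 0); rewrite big1 // => j _; rewrite mul0r.
- exists (fun j => c j + d j); rewrite -big_split /=.
  by apply: eq_bigr => j _; rewrite mulrDl.
- exists (fun j => p * c j); rewrite mulr_sumr.
  by apply: eq_bigr => j _; rewrite mulrA.
Qed.

Lemma ideal_generated_mem (R : comNzRingType) (F : seq R) (p : R) :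
  p \in F -> ideal_generated F p.
Proof.
move=> /(nthP 0)[j lt_jF <-]; exists (fun i => ((i : nat) == j)%:R).
rewrite (bigD1 (Ordinal lt_jF)) //= eqxx mul1r big1 ?addr0 // => i.
by rewrite -val_eqE /= => /negbTE ->; rewrite mul0r.
Qed.

Section IdealTheory.

Variables (R : comNzRingType) (I : R -> Prop) (hI : ideal_pred I).

Lemma idealMr p q : I p -> I (p * q).
Proof. by rewrite mulrC; apply: idealMl. Qed.

Lemma idealN p : I p -> I (- p).
Proof. by rewrite -mulN1r; apply: idealMl. Qed.

Lemma idealB p q : I p -> I q -> I (p - q).
Proof. by move=> Ip Iq; apply: idealD => //; apply: idealN. Qed.

Lemma ideal_sum (J : Type) (r : seq J) (P : pred J) (f : J -> R) :
  (forall j, P j -> I (f j)) -> I (\sum_(j <- r | P j) f j).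
Proof.
by move=> If; elim/big_ind: _ => //; [apply: ideal0|apply: idealD].
Qed.

Lemma ideal_horner (p : {poly R}) x : (forall j, I p`_j) -> I p.[x].
Proof.
by move=> Ip; rewrite horner_coef; apply: ideal_sum => j _; apply: idealMr.
Qed.

End IdealTheory.

Record subring_pred (R : comNzRingType) (B : R -> Prop) : Prop := {
  subring0 : B 0;
  subring1 : B 1;
  subringD : forall p q, B p -> B q -> B (p + q);
  subringM : forall p q, B p -> B q -> B (p * q) }.

Lemma subring_sum (R : comNzRingType) (B : R -> Prop) (hB : subring_pred B)
    (J : Type) (r : seq J) (P : pred J) (f : J -> R) :
  (forall j, P j -> B (f j)) -> B (\sum_(j <- r | P j) f j).
Proof.
by move=> Bf; elim/big_ind: _ => //; [apply: subring0|apply: subringD].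
Qed.

Lemma subring_exp (R : comNzRingType) (B : R -> Prop) (hB : subring_pred B)
    p n : B p -> B (p ^+ n).
Proof.
move=> Bp; elim: n => [|n IHn]; first exact: (subring1 hB).
by rewrite exprS; apply: subringM.
Qed.

Section AdjoinSeq.

Variables (R : comNzRingType) (B0 : R -> Prop) (Z : nat -> R).

(** The subrings [B0[Z 0, .., Z (i - 1)]]. Each stage is presented by polynomials in its last
    generator alone, the form needed to divide by a relation for that generator. *)
Fixpoint adjoin_seq (i : nat) : R -> Prop :=
  if i is i'.+1 then fun p =>
    exists2 P : {poly R}, (forall j, adjoin_seq i' P`_j) & p = P.[Z i']
  else B0.

Hypothesis hB0 : subring_pred B0.

Lemma adjoin_seq_subring i : subring_pred (adjoin_seq i).
Proof.
elim: i => //= i IHi; split=> [||p q [P BP ->] [Q BQ ->]|p q [P BP ->] [Q BQ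
  ->]].
- by exists 0 => [j|]; rewrite ?coef0 ?horner0 //; apply: subring0.
- exists 1; last by rewrite hornerC.
  by move=> j; rewrite coef1; case: (_ == _); [apply: subring1|apply: subring0].
- by exists (P + Q) => [j|]; rewrite ?coefD ?hornerD //; apply: subringD.
- exists (P * Q) => [j|]; rewrite ?hornerM // coefM.
  by apply: subring_sum => // ? _; apply: subringM.
Qed.

Lemma adjoin_seq_step i p : adjoin_seq i p -> adjoin_seq i.+1 p.
Proof.
move=> Bp; exists p%:P; last by rewrite hornerC.
by move=> j; rewrite coefC; case: (_ == _) => //; apply: (subring0
  (adjoin_seq_subring i)).
Qed.

Lemma adjoin_seq_le i j p : (i <= j)%N -> adjoin_seq i p -> adjoin_seq j p.
Proof.
move/subnK <-; elim: (j - i)%N => // d IHd Bp.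
exact: adjoin_seq_step (IHd Bp).
Qed.

Lemma adjoin_seq_gen i j : (i < j)%N -> adjoin_seq j (Z i).
Proof.
move=> ltij; apply: adjoin_seq_le ltij _; exists 'X; last by rewrite hornerX.
have hB := adjoin_seq_subring i.
by move=> n; rewrite coefX; case: (_ == _); [apply: subring1|apply: subring0].
Qed.

Variables (I : R -> Prop) (hI : ideal_pred I).
Variables (W : fieldType) (phi : {rmorphism R -> W}).
Hypothesis phiI : forall p, I p -> phi p = 0.
Variables (l M : nat).
Hypothesis kerB0 : forall p, B0 p -> phi p = 0 -> I p.
Hypothesis reduce : forall i, (i < M)%N -> exists lead (low : {poly R}),
  [/\ B0 lead, (exists w, I (lead * w - 1)),
      forall j, B0 low`_j, (size low <= l)%N
    & I (lead * Z i ^+ l - low.[Z i])].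
Hypothesis indep : forall i (P : {poly R}), (i < M)%N ->
  (forall j, adjoin_seq i P`_j) -> (size P <= l)%N ->
  (map_poly phi P).[phi (Z i)] = 0 -> forall j, phi P`_j = 0.

Let reduce_poly i (P : {poly R}) : (i < M)%N -> (forall j, adjoin_seq i P`_j) ->
  exists d (r : {poly R}), [/\ B0 d, (exists w, I (d * w - 1)), forall j,
    adjoin_seq i r`_j,
    (size r <= l)%N & I (d * P.[Z i] - r.[Z i])].
Proof.
move=> ltiM; have [lead [low [Blead [w Iw] Blow szlow Ilow]]] := reduce ltiM.
have hB := adjoin_seq_subring i.
have B0i p : B0 p -> adjoin_seq i p by apply: (@adjoin_seq_le 0).
elim: {P}(size P) {-2}P (leqnn (size P)) => [|n IHn] P szP BP.
  exists 1, P; split=> //; first exact: subring1.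
  - by exists 1; rewrite mulr1 subrr; apply: ideal0.
  - exact: leq_trans szP _.
  - by rewrite mul1r subrr; apply: ideal0.
have [szPl|ltlP] := leqP (size P) l.
  exists 1, P; split=> //; first exact: subring1.
  - by exists 1; rewrite mulr1 subrr; apply: ideal0.
  - by rewrite mul1r subrr; apply: ideal0.
have leln : (l <= n)%N by rewrite -ltnS (leq_trans ltlP).
(* This is [lead *: P] with [lead *: 'X^l] replaced by [low] in its top term; its value at [Z i]
   changes only by an element of [I]. *)
pose P' := lead *: take_poly n P + P`_n *: ('X^(n - l) * low).
have defP : P = take_poly n P + P`_n *: 'X^n.
  apply/polyP=> j; rewrite coefD coefZ coefXn coef_take_poly.
  have [ltjn|ltnj|->] := ltngtP; rewrite ?mulr0 ?addr0 ?mulr1 ?add0r //.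
  by rewrite nth_default // (leq_trans szP).
have szP' : (size P' <= n)%N.
  rewrite (leq_trans (size_polyD _ _)) // geq_max.
  rewrite !(leq_trans (size_scale_leq _ _)) ?size_take_poly //.
  rewrite (leq_trans (size_polyMleq _ _)) // size_polyXn /=.
  by rewrite -(leq_add2l (n - l)) in szlow; rewrite subnK in szlow.
have BP' j : adjoin_seq i P'`_j.
  rewrite coefD !coefZ coefXnM coef_take_poly.
  have B00 := subring0 hB.
  apply: (subringD hB); apply: (subringM hB); rewrite ?BP //; first exact: B0i.
    by case: ifP.
  by case: ifP => // _; apply: B0i.
have [d [r [Bd [v Iv] Br szr Ir]]] := IHn P' szP' BP'.
exists (d * lead), r; split=> //; first exact: subringM.
  exists (w * v).
  rewrite (_ : _ - 1 = (d * v) * (lead * w - 1) + (d * v - 1)).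
    by apply: idealD => //; apply: idealMl.
  by ring.
have -> : d * lead * P.[Z i] - r.[Z i]
    = d * (P`_n * Z i ^+ (n - l) * (lead * Z i ^+ l - low.[Z i]))
      + (d * P'.[Z i] - r.[Z i]).
  have -> : P.[Z i] = (take_poly n P).[Z i] + P`_n * Z i ^+ (n - l) * Z i ^+ l.
    by rewrite {1}defP hornerD hornerZ hornerXn -mulrA -exprD subnK.
  rewrite /P' hornerD !hornerZ hornerM hornerXn.
  by ring.
by apply: idealD => //; do 2 apply: idealMl => //.
Qed.

(* Pseudo-division by the [i]-th relation leaves a remainder of degree less than
   [l], whose coefficients vanish in [W] by [indep]; the leading coefficients
   are units modulo [I], so they can be cancelled. *)
Lemma adjoin_seq_ker i p : (i <= M)%N -> adjoin_seq i p -> phi p = 0 -> I p.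
Proof.
elim: i p => [|i IHi] p; first by move=> _; apply: kerB0.
move=> ltiM [P BP ->] phiP0.
have [d [r [Bd [w Iw] Br szr Ir]]] := reduce_poly ltiM BP.
have phir : phi r.[Z i] = 0.
  by have := phiI Ir; rewrite rmorphB rmorphM phiP0 mulr0 => /eqP; rewrite
    subr_eq0 => /eqP <-.
rewrite -horner_map /= in phir.
have Irc : I r.[Z i].
  apply: ideal_horner => // j; apply: IHi => //; first exact: ltnW.
  exact: indep phir j.
have IdP : I (d * P.[Z i]) by rewrite -(subrK r.[Z i] (d * _)); apply: idealD.
rewrite (_ : P.[Z i] = w * (d * P.[Z i]) - P.[Z i] * (d * w - 1)); last first.
  by ring.
by apply: idealB => //; apply: idealMl.
Qed.

(** Once the subrings exhaust [R], the ideal [I] is the kernel of [phi], and the kernel of a map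
    into a field is prime. *)
Lemma adjoin_seq_prime :
  (forall p, adjoin_seq M p) -> prime_ideal I.
Proof.
move=> BM; split=> [/phiI|p q /phiI]; first by rewrite rmorph1 => /eqP; rewrite
  oner_eq0.
rewrite rmorphM => /eqP; rewrite mulf_eq0 => /orP[]/eqP h; [left|right].
  exact: (adjoin_seq_ker (leqnn M)).
exact: (adjoin_seq_ker (leqnn M)).
Qed.

End AdjoinSeq.

(** * Towers of cyclic extensions *)

Lemma natr_uniq_pchar (R : nzRingType) (p : nat) : p \in [pchar R] ->
  uniq [seq (i%:R : R) | i <- iota 0 p].
Proof.
move=> pR; rewrite map_inj_in_uniq ?iota_uniq // => i j.
rewrite !mem_iota !add0n /=.
wlog leij : i j / (i <= j)%N => [IH|ltip ltjp /eqP].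
  have [leij|/ltnW leji] := leqP i j; first exact: IH.
  by move=> ltip ltjp ij; apply/esym; apply: IH.
rewrite eq_sym -subr_eq0 -natrB // -(dvdn_pcharf pR) => dvp.
apply/eqP; rewrite eqn_leq leij -subn_eq0 /=.
apply: contraLR dvp; rewrite -lt0n => lt0; rewrite gtnNdvd //.
exact: leq_ltn_trans (leq_subr _ _) ltjp.
Qed.

Lemma natrX_pchar (R : comNzRingType) (p : nat) (n : nat) : p \in [pchar R] ->
  (n%:R : R) ^+ p = n%:R.
Proof. by move=> pR; rewrite -(pFrobenius_autE pR) pFrobenius_aut_nat. Qed.

Section CyclicPolynomials.

Variables (E : fieldType) (l : nat).
Hypothesis l_pr : prime l.

Lemma kummer_factor (z x : E) : l.-primitive_root z -> x != 0 ->
  'X^l - (x ^+ l)%:P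
  = \prod_(y <- [seq z ^+ i * x | i <- iota 0 l]) ('X - y%:P).
Proof.
move=> z_prim x0; have l_gt0 := prime_gt0 l_pr.
rewrite [LHS](@all_roots_prod_XsubC _ _ [seq z ^+ i * x | i <- iota 0 l]).
- by rewrite (monicP (monicXnsubC _ l_gt0)) scale1r.
- by rewrite size_XnsubC // size_map size_iota.
- apply/allP=> _ /mapP[i _ ->]; rewrite rootE !hornerE exprMn.
  by rewrite exprAC (prim_expr_order z_prim) expr1n mul1r subrr.
- rewrite uniq_rootsE map_inj_in_uniq ?iota_uniq // => i j.
  rewrite !mem_iota !add0n /= => ltil ltjl /(mulIf x0)/eqP.
  by rewrite (eq_prim_root_expr z_prim) !modn_small // => /eqP.
Qed.

Lemma artin_schreier_size (a : E) : size ('X^l - 'X - a%:P) = l.+1.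
Proof.
rewrite -addrA size_polyDl size_polyXn // -opprD size_polyN.
by rewrite size_XaddC ltnS prime_gt1.
Qed.

Lemma artin_schreier_monic (a : E) : 'X^l - 'X - a%:P \is monic.
Proof.
rewrite monicE lead_coefE artin_schreier_size /=.
rewrite !coefB coefXn coefX coefC eqxx gtn_eqF ?prime_gt1 //.
by rewrite gtn_eqF ?prime_gt0 // !subr0.
Qed.

Lemma artin_schreier_factor (x : E) : l \in [pchar E] ->
  'X^l - 'X - (x ^+ l - x)%:P
  = \prod_(y <- [seq x + i%:R | i <- iota 0 l]) ('X - y%:P).
Proof.
move=> lE; rewrite [LHS](@all_roots_prod_XsubC _ _ [seq x + i%:R | i <- iota 0
  l]).
- by rewrite (monicP (artin_schreier_monic _)) scale1r.
- by rewrite artin_schreier_size size_map size_iota.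
- apply/allP=> _ /mapP[i _ ->]; rewrite rootE !hornerE.
  rewrite exprDn_pchar ?pnatE // natrX_pchar //.
  by apply/eqP; ring.
- rewrite uniq_rootsE map_comp map_inj_uniq ?natr_uniq_pchar //.
  exact: addrI.
Qed.

(** Such an [x] is a root of ['X^l - 'X], whose factorization is the preceding one at [0]. *)
Lemma frobenius_fixed (x : E) : l \in [pchar E] -> x ^+ l = x ->
  exists i, x = i%:R.
Proof.
move=> lE xl; have := artin_schreier_factor 0 lE.
rewrite expr0n gtn_eqF ?prime_gt0 // !subr0 => /(congr1 (horner^~ x)).
rewrite !hornerE xl subrr => /esym/rootP; rewrite root_prod_XsubC.
by case/mapP=> i _ ->; exists i; rewrite add0r.
Qed.

End CyclicPolynomials.

Section CyclicTower.

Variables (F : fieldType) (E : fieldExtType F) (l : nat).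
Hypothesis l_pr : prime l.

(** Shared by the Kummer and Artin-Schreier cases, which differ only in how they exclude a degree
    below [l]. The minimal polynomial divides [p], and in degree [l] the two monic polynomials
    agree. *)
Lemma adjoin_degree_prime (K : {subfield E}) (x : E) (p : {poly E}) :
    p \is a polyOver K -> p \is monic -> size p = l.+1 -> root p x ->
    ((adjoin_degree K x < l)%N -> x \in K) -> x \notin K ->
  adjoin_degree K x = l /\ minPoly K x = p.
Proof.
move=> Kp p_mon szp px0 small xK.
have dvp := minPoly_dvdp Kp px0.
have: (adjoin_degree K x <= l)%N.
  by have := dvdp_leq (monic_neq0 p_mon) dvp; rewrite size_minPoly szp.
rewrite leq_eqVlt => /orP[/eqP deg|ltdl].
  split=> //; apply/eqP; rewrite -eqp_monic ?monic_minPoly //.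
  by rewrite -dvdp_size_eqp // size_minPoly szp deg.
by rewrite small in xK.
Qed.

Section Kummer.

Variable z : E.
Hypothesis z_prim : l.-primitive_root z.

Lemma kummer_degree (K : {subfield E}) (x : E) :
    z \in K -> x ^+ l \in K -> x \notin K ->
  adjoin_degree K x = l /\ minPoly K x = 'X^l - (x ^+ l)%:P.
Proof.
move=> zK xlK xK; have l_gt0 := prime_gt0 l_pr.
have x0 : x != 0 by apply: contraNneq xK => ->; apply: mem0v.
apply: adjoin_degree_prime => //.
- by rewrite rpredB ?rpredX ?polyOverX ?polyOverC.
- exact: monicXnsubC.
- exact: size_XnsubC.
- by rewrite rootE !hornerE subrr.
set d := adjoin_degree K x => ltdl.
have d_gt0 : (0 < d)%N by [].

have /dvdp_prod_XsubC[m] : minPoly K x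
    %| \prod_(y <- [seq z ^+ i * x | i <- iota 0 l]) ('X - y%:P).
  rewrite -kummer_factor //; apply: minPoly_dvdp.
    by rewrite rpredB ?rpredX ?polyOverX ?polyOverC.
  by rewrite rootE !hornerE subrr.
set s := mask m _; rewrite eqp_monic ?monic_minPoly ?monic_prod_XsubC //.
move=> /eqP defm.
have szs : size s = d.
  by apply: succn_inj; rewrite -size_minPoly defm size_prod_XsubC.
(* The constant term of the minimal polynomial is, up to a unit of [K], the
   power of [x] of exponent [d], which is prime to [l]. *)
have [c cK cE] : exists2 c, c \in K & (c != 0) && (\prod_(y <- s) y == c * x ^+
  d).
  have : {subset s <= [seq z ^+ i * x | i <- iota 0 l]} by move=> t; apply:
    mem_mask.
  rewrite -szs; elim: {defm szs}s => [|y s IHs] sub.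
    by exists 1; rewrite ?mem1v // big_nil mulr1 oner_eq0 eqxx.
  have [c cK /andP[c0 /eqP cE]] := IHs (fun t ts => sub t (mem_behead (ts : t
    \in behead (y :: s)))).
  have /mapP[i _ ->] := sub y (mem_head _ _).
  exists (z ^+ i * c); first by rewrite rpredM ?rpredX.
  rewrite mulf_neq0 ?expf_neq0 ?(prim_root_eq0 z_prim) ?gtn_eqF //.
  by rewrite big_cons cE /= exprS mulrACA.
have xdK : x ^+ d \in K.
  have [c0 /eqP cxd] := andP cE.
  have : (minPoly K x).[0] \in K by apply: rpred_horner; rewrite ?minPolyOver
    ?mem0v.
  rewrite defm horner_prod (eq_bigr (fun y => -1 * y)); last first.
    by move=> y _; rewrite !hornerE mulN1r.
  rewrite big_split /= cxd mulrA fpredMl //.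
    by rewrite rpredM // rpred_prod // => y _; rewrite rpredN mem1v.
  by rewrite mulf_neq0 // prodf_seq_neq0; apply/allP => y _; rewrite oppr_eq0
    oner_eq0.
have /eqP dl : coprime d l by rewrite coprime_sym prime_coprime // gtnNdvd.
(* Bezout gives [a * d = b * l + 1], so [x] is the quotient of [x ^+ (a * d)] by a power of
   [x ^+ l], both in [K]. *)
have [a b ab _] := egcdnP l d_gt0.
have : x ^+ (a * d) \in K by rewrite mulnC exprM rpredX.
have xlbK : (x ^+ l) ^+ b \in K by apply: rpredX.
by rewrite ab dl addn1 exprS mulnC exprM fpredMr // !expf_neq0.
Qed.

(** As [y ^+ l] lies in [K], the conjugation [x |-> z * x] multiplies [y] by some [z ^+ e]. Written
    as a polynomial of degree less than [l] in [x], [y] can then contain only the monomial of degree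
    [e]. *)
Lemma kummer_descent (K : {subfield E}) (x y : E) :
    z \in K -> x ^+ l \in K -> x \notin K -> y \in <<K; x>>%VS -> y ^+ l \in K
      ->
  exists c e, c \in K /\ y = c * x ^+ e.
Proof.
move=> zK xlK xK yKx ylK; have [deg minp] := kummer_degree zK xlK xK.
set p := Fadjoin_poly K x y.
have Kp : p \is a polyOver K by apply: Fadjoin_polyOver.
have szp : (size p <= l)%N by rewrite -deg size_Fadjoin_poly.
have defy : y = p.[x] by rewrite Fadjoin_poly_eq.
(* Twisting [p] by the would-be automorphism [x |-> z * x]. *)
pose q := p \Po (z *: 'X).
have ql : q.[x] ^+ l = y ^+ l.
  have /dvdpP[r defr] : minPoly K x %| p ^+ l - (y ^+ l)%:P.
    apply: minPoly_dvdp; first by rewrite rpredB ?rpredX ?polyOverC.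
    by rewrite rootE !hornerE -defy subrr.
  have := congr1 (fun f => (f \Po (z *: 'X)).[x]) defr.
  rewrite minp comp_polyM comp_polyB rmorphXn /= comp_polyC !hornerE -/q =>
    /eqP.
  rewrite comp_polyB comp_polyC rmorphXn /= comp_polyX !hornerE.
  rewrite exprMn (prim_expr_order z_prim) mul1r subrr mulr0 subr_eq0.
  by move/eqP.
have [y0|y0] := eqVneq y 0.
  by exists 0, 0%N; rewrite mem0v mul0r.
have [[e lte] /= qe] : {i : 'I_l | q.[x] / y = z ^+ i}.
  by apply: (prim_rootP z_prim); rewrite exprMn exprVn ql divff ?expf_neq0.
have {}qe : q.[x] = z ^+ e * p.[x] by rewrite -defy -qe divfK.
have qp : q = z ^+ e *: p.
  apply/eqP; rewrite -subr_eq0 -(@root_small_adjoin_poly _ _ K x).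
  - by rewrite rootE !hornerE qe subrr.
  - rewrite rpredB ?polyOverZ ?rpredX //.
    by rewrite polyOver_comp // polyOverZ ?polyOverX.
  - rewrite deg (leq_trans (size_polyD _ _)) // size_polyN geq_max.
    rewrite (leq_trans (size_scale_leq _ _)) // andbT.
    rewrite size_comp_poly2 // size_scale ?size_polyX //.
    by rewrite (prim_root_eq0 z_prim) gtn_eqF ?prime_gt0.
exists p`_e, e; split; first exact: (polyOverP Kp).
rewrite defy horner_coef (bigID (fun i : 'I__ => i == e :> nat)) /=.
rewrite [X in _ + X]big1 ?addr0.
  have [ltep|leep] := ltnP e (size p).
    by rewrite (big_pred1 (Ordinal ltep)).
  rewrite nth_default // mul0r big1 // => i /eqP ie.
  by rewrite ie nth_default ?mul0r.
move=> i ie; suff /eqP -> : p`_i == 0 by rewrite mul0r.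
have := congr1 (fun f : {poly E} => f`_i) qp; rewrite coefZ.
have -> : q`_i = z ^+ i * p`_i.
  rewrite /q; have -> : p \Po (z *: 'X) = \poly_(j < size p) (z ^+ j * p`_j).
    rewrite comp_polyE poly_def; apply: eq_bigr => j _.
    by rewrite exprZn scalerA mulrC.
  by rewrite coef_poly ltn_ord.
move/eqP; rewrite -subr_eq0 -mulrBl mulf_eq0 subr_eq0 (eq_prim_root_expr
  z_prim).
by rewrite !modn_small ?(negPf ie) // (leq_trans (ltn_ord i)).
Qed.

End Kummer.

Section ArtinSchreier.

Hypothesis lE : l \in [pchar E].

Lemma artin_schreier_degree (K : {subfield E}) (x : E) :
    x ^+ l - x \in K -> x \notin K ->
  adjoin_degree K x = l /\ minPoly K x = 'X^l - 'X - (x ^+ l - x)%:P.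
Proof.
move=> xlK xK; have l_gt0 := prime_gt0 l_pr.
have KP : 'X^l - 'X - (x ^+ l - x)%:P \is a polyOver K.
  by rewrite !rpredB ?rpredX ?polyOverX // polyOverC.
have Px : root ('X^l - 'X - (x ^+ l - x)%:P) x.
  by rewrite rootE !hornerE subrr.
apply: adjoin_degree_prime => //.
- exact: artin_schreier_monic.
- exact: artin_schreier_size.
set d := adjoin_degree K x => ltdl.
have d_gt0 : (0 < d)%N by [].

have /dvdp_prod_XsubC[m] : minPoly K x
    %| \prod_(y <- [seq x + i%:R | i <- iota 0 l]) ('X - y%:P).
  by rewrite -artin_schreier_factor //; apply: minPoly_dvdp.
set s := mask m _; rewrite eqp_monic ?monic_minPoly ?monic_prod_XsubC //.
move=> /eqP defm.
have szs : size s = d.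
  by apply: succn_inj; rewrite -size_minPoly defm size_prod_XsubC.
(* The sum of the roots replaces the product used in the Kummer case. It is a coefficient of the
   minimal polynomial up to sign, hence in [K], and [d] is invertible in [E] because it is positive
   and less than the characteristic. *)
have [c cK cE] : exists2 c, c \in K & \sum_(y <- s) y = c + x *+ d.
  have : {subset s <= [seq x + i%:R | i <- iota 0 l]} by move=> t; apply:
    mem_mask.
  rewrite -szs; elim: {defm szs}s => [|y s IHs] sub.
    by exists 0; rewrite ?mem0v // big_nil mulr0n addr0.
  have [c cK cE] := IHs (fun t ts => sub t (mem_behead (ts : t \in behead (y ::
    s)))).
  have /mapP[i _ ->] := sub y (mem_head _ _).
  exists (i%:R + c); first by rewrite rpredD ?rpred_nat.
  rewrite big_cons cE /= mulrS [x + i%:R]addrC -!addrA.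
  by congr (_ + _); rewrite addrCA.
have : (minPoly K x)`_d.-1 \in K by apply: (polyOverP (minPolyOver K x)).
rewrite defm -szs coefPn_prod_XsubC ?szs -?lt0n // cE rpredN rpredDl //.
have d0 : d%:R != 0 :> E by rewrite -(dvdn_pcharf lE) gtnNdvd.
have dK : d%:R \in K by apply: rpred_nat.
by rewrite -mulr_natr fpredMr.
Qed.

(** The conjugation [x |-> x + 1] adds to [y] an element [e] of the prime field. Removing [e *: 'X]
    from the polynomial [p] that represents [y] leaves one that is invariant under translation by
    [1]. It takes a single value on the [l] elements of the prime field and has degree less than
    [l], so it is constant. *)
Lemma artin_schreier_descent (K : {subfield E}) (x y : E) :
    x ^+ l - x \in K -> x \notin K -> y \in <<K; x>>%VS -> y ^+ l - y \in K ->
  exists c e, c \in K /\ y = c + x *+ e.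
Proof.
move=> xlK xK yKx ylK; have [deg minp] := artin_schreier_degree xlK xK.
set p := Fadjoin_poly K x y.
have Kp : p \is a polyOver K by apply: Fadjoin_polyOver.
have szp : (size p <= l)%N by rewrite -deg size_Fadjoin_poly.
have defy : y = p.[x] by rewrite Fadjoin_poly_eq.
have lP : l.-nat l by rewrite pnat_id.
have lEP : [pchar E].-nat l by rewrite pnatE.
(* Twisting [p] by the would-be automorphism [x |-> x + 1]. *)
pose q := p \Po ('X + 1).
have ql : q.[x] ^+ l - q.[x] = y ^+ l - y.
  have /dvdpP[r defr] : minPoly K x %| p ^+ l - p - (y ^+ l - y)%:P.
    apply: minPoly_dvdp; first by rewrite !rpredB ?rpredX ?polyOverC.
    by rewrite rootE !hornerE -defy subrr.
  have := congr1 (fun f => (f \Po ('X + 1)).[x]) defr.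
  rewrite minp comp_polyM !comp_polyB !rmorphXn /= !comp_polyC comp_polyX.
  rewrite !hornerE -/q => /eqP.
  have -> : (x + 1) ^+ l - (x + 1) - (x ^+ l - x) = 0.
    by rewrite exprDn_pchar // expr1n; ring.
  by rewrite mulr0 subr_eq0 => /eqP.
have [e qe] : exists e, q.[x] - y = e%:R.
  apply: (frobenius_fixed l_pr lE).
  rewrite exprDn_pchar // exprNn_pchar //.
  have -> : q.[x] ^+ l = y ^+ l - y + q.[x] by rewrite -ql subrK.
  by ring.
pose r := p - e%:R *: 'X.
have qp : r \Po ('X + 1) = r.
  have : q = p + e%:R%:P.
    apply/eqP; rewrite -subr_eq0 -(@root_small_adjoin_poly _ _ K x).
    - by rewrite rootE !hornerE -defy -qe; apply/eqP; ring.
    - rewrite rpredB // ?rpredD ?polyOverC ?rpred_nat //.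
      by rewrite polyOver_comp // rpredD ?polyOverX ?rpred1.
    - rewrite deg (leq_trans (size_polyD _ _)) // size_polyN geq_max.
      rewrite size_comp_poly2 ?size_XaddC // szp.
      rewrite (leq_trans (size_polyD _ _)) // geq_max szp.
      by rewrite (leq_trans (size_polyC_leq1 _)) ?prime_gt0.
  rewrite /r comp_polyB comp_polyZ comp_polyX -/q => ->.
  by rewrite scalerDr alg_polyC; ring.
have rC : r = r.[0]%:P.
  apply/eqP; rewrite -subr_eq0; apply/eqP.
  apply: (@roots_geq_poly_eq0 _ _ [seq (i%:R : E) | i <- iota 0 l]).
  - apply/allP => _ /mapP[i _ ->]; rewrite rootE hornerD hornerN hornerC
    subr_eq0.
    apply/eqP; elim: i => [|i IHi]; first by [].
    by rewrite -IHi -{2}qp horner_comp !hornerE natr1.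
  - by rewrite natr_uniq_pchar.
  - rewrite size_map size_iota (leq_trans (size_polyD _ _)) // size_polyN.
    rewrite geq_max (leq_trans (size_polyC_leq1 _)) ?prime_gt0 // andbT.
    rewrite (leq_trans (size_polyD _ _)) // geq_max szp size_polyN.
    by rewrite (leq_trans (size_scale_leq _ _)) // size_polyX prime_gt1.
exists r.[0], e; split.
  apply: rpred_horner; rewrite ?mem0v // rpredB // polyOverZ ?polyOverX //.
  by rewrite rpred_nat.
have := congr1 (horner^~ x) rC.
rewrite hornerC hornerD hornerN hornerZ hornerX -defy mulr_natl.
by move/(canRL (subrK _)).
Qed.

End ArtinSchreier.

End CyclicTower.

Section Tower.

Variables (F : fieldType) (E : fieldExtType F) (l : nat).
Hypothesis l_pr : prime l.

Fixpoint tower (K : {subfield E}) (rho : nat -> E) (i : nat) : {subfield E} :=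
  if i is i'.+1 then <<tower K rho i'; rho i'>>%AS else K.

Lemma subv_tower (K : {subfield E}) (rho : nat -> E) (i : nat) : (K <= tower K
  rho i)%VS.
Proof.
elim: i => [|i IHi]; first exact: subvv.
exact: subv_trans IHi (subv_adjoin _ _).
Qed.

Variables (rho : nat -> E) (M : nat).

(** The last hypothesis is independence of the elements [rho i ^+ l] modulo [l]-th powers of [K]. It
    persists for the later elements over each stage: if their product is [y ^+ l], then
    [kummer_descent] gives [y = c * rho i ^+ e], which turns the relation into one over the stage
    below. *)
Lemma kummer_tower_degree (z : E) (K : {subfield E}) :
    l.-primitive_root z -> z \in K ->
    (forall i, rho i != 0 /\ rho i ^+ l \in K) ->
    (forall (n : nat -> nat) y, y \in K ->
      \prod_(0 <= i < M) rho i ^+ (l * n i) = y ^+ l ->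
      forall i, (i < M)%N -> (l %| n i)%N) ->
  forall i, (i < M)%N -> adjoin_degree (tower K rho i) (rho i) = l.
Proof.
move=> z_prim zK rhoK indep.
pose indep_from (K' : {subfield E}) a := forall (n : nat -> nat) y, y \in K' ->
  \prod_(a <= i < M) rho i ^+ (l * n i) = y ^+ l ->
  forall i, (a <= i < M)%N -> (l %| n i)%N.
have zT i : z \in tower K rho i by apply: (subvP (subv_tower _ _ _)).
have rhoT i j : rho j ^+ l \in tower K rho i.
  by apply: (subvP (subv_tower _ _ _)); case: (rhoK j).
have notT i : (i < M)%N -> indep_from (tower K rho i) i ->
    rho i \notin tower K rho i.
  move=> ltiM ind; apply/negP => rhoi.
  have := ind (fun j => (j == i)%N) (rho i) rhoi.
  rewrite big_ltn // eqxx muln1 big_nat_cond big1 => [|j].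
    rewrite mulr1 => /(_ erefl i); rewrite leqnn ltiM eqxx dvdn1 => /(_ isT)
      /eqP l1.
    by move: l_pr; rewrite l1.
  by rewrite andbT => /andP[ltij _]; rewrite gtn_eqF // muln0.
have indT i : (i <= M)%N -> indep_from (tower K rho i) i.
  elim: i => [_ n y yK eqy j|i IHi ltiM n y yK eqy j /andP[ltij ltjM]].
    exact: indep eqy j.
  have IH := IHi (ltnW ltiM).
  have ylK : y ^+ l \in tower K rho i.
    by rewrite -eqy big_nat_cond rpred_prod // => k _; rewrite exprM; apply:
      rpredX; apply: rhoT.
  have [c [e [cK yE]]] :=
    kummer_descent l_pr z_prim (zT i) (rhoT i i) (notT _ ltiM IH) yK ylK.
  (* The exponent [e * l.-1] completes the factor [(rho i ^+ l) ^+ e] of [y ^+ l] to an [l]-th power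
     from stage [i]. *)
  have := IH (fun k => if k == i then (e * l.-1)%N else n k) (c * (rho i ^+ l)
    ^+ e).
  have cK' : c * (rho i ^+ l) ^+ e \in tower K rho i.
    by apply: rpredM => //; apply: rpredX; apply: rhoT.
  move=> /(_ cK'); rewrite big_ltn // eqxx.
  rewrite (_ : \prod_(i.+1 <= k < M) _ = y ^+ l); last first.
    rewrite -eqy; apply: eq_big_nat => k /andP[ltik _].
    by rewrite gtn_eqF.
  rewrite yE !exprMn -!exprM mulrCA -exprD.
  have -> : (l * (e * l.-1) + e * l = l * e * l)%N.
    by rewrite [(e * l)%N]mulnC mulnA -mulnSr prednK ?prime_gt0.
  by move=> /(_ erefl j); rewrite ltnW // ltjM gtn_eqF // => /(_ isT).
by move=> i ltiM; case: (kummer_degree l_pr z_prim (zT i) (rhoT i i)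
  (notT i ltiM (indT i (ltnW ltiM)))).
Qed.

Lemma artin_schreier_tower_degree (K : {subfield E}) :
    l \in [pchar E] ->
    (forall i, rho i ^+ l - rho i \in K) ->
    (forall (n : nat -> nat) y, y \in K ->
      \sum_(0 <= i < M) (rho i ^+ l - rho i) *+ n i = y ^+ l - y ->
      forall i, (i < M)%N -> (l %| n i)%N) ->
  forall i, (i < M)%N -> adjoin_degree (tower K rho i) (rho i) = l.
Proof.
move=> lE rhoK indep.
pose indep_from (K' : {subfield E}) a := forall (n : nat -> nat) y, y \in K' ->
  \sum_(a <= i < M) (rho i ^+ l - rho i) *+ n i = y ^+ l - y ->
  forall i, (a <= i < M)%N -> (l %| n i)%N.
have rhoT i j : rho j ^+ l - rho j \in tower K rho i.
  exact: (subvP (subv_tower _ _ _)).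
have notT i : (i < M)%N -> indep_from (tower K rho i) i ->
    rho i \notin tower K rho i.
  move=> ltiM ind; apply/negP => rhoi.
  have := ind (fun j => (j == i)%N) (rho i) rhoi.
  rewrite big_ltn // eqxx mulr1n big_nat_cond big1 => [|j].
    rewrite addr0 => /(_ erefl i); rewrite leqnn ltiM eqxx dvdn1 => /(_ isT)
      /eqP l1.
    by move: l_pr; rewrite l1.
  by rewrite andbT => /andP[ltij _]; rewrite gtn_eqF // mulr0n.
have lEP : [pchar E].-nat l by rewrite pnatE.
have indT i : (i <= M)%N -> indep_from (tower K rho i) i.
  elim: i => [_ n y yK eqy j|i IHi ltiM n y yK eqy j /andP[ltij ltjM]].
    exact: indep eqy j.
  have IH := IHi (ltnW ltiM).
  have ylK : y ^+ l - y \in tower K rho i.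
    by rewrite -eqy big_nat_cond rpred_sum // => k _; rewrite rpredMn ?rhoT.
  have [c [e [cK yE]]] :=
    artin_schreier_descent l_pr lE (rhoT i i) (notT _ ltiM IH) yK ylK.
  (* In characteristic [l] the multiplicity [e * l.-1] acts as [- e] and cancels the contribution of
     [rho i *+ e] to [y ^+ l - y]. *)
  have := IH (fun k => if k == i then (e * l.-1)%N else n k) c cK.
  rewrite big_ltn // eqxx.
  rewrite (_ : \sum_(i.+1 <= k < M) _ = y ^+ l - y); last first.
    rewrite -eqy; apply: eq_big_nat => k /andP[ltik _].
    by rewrite gtn_eqF.
  rewrite yE exprDn_pchar // -[rho i *+ e]mulr_natr exprMn natrX_pchar //.
  have -> : (rho i ^+ l - rho i) *+ (e * l.-1) = - ((rho i ^+ l - rho i) *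
    e%:R).
    apply/eqP; rewrite -subr_eq0 opprK mulr_natr -mulrnDr.
    rewrite -mulnSr prednK ?prime_gt0 // -mulr_natr.
    by rewrite (eqP (_ : (e * l)%:R == 0)) ?mulr0 // -(dvdn_pcharf lE)
      dvdn_mull.
  have -> : - ((rho i ^+ l - rho i) * e%:R)
      + (c ^+ l + rho i ^+ l * e%:R - (c + rho i * e%:R)) = c ^+ l - c by ring.
  by move=> /(_ erefl j); rewrite ltnW // ltjM gtn_eqF // => /(_ isT).
by move=> i ltiM; case: (artin_schreier_degree l_pr lE (rhoT i i)
  (notT i ltiM (indT i (ltnW ltiM)))).
Qed.

End Tower.

(** * Independence of the branch data in the rational function field *)

Section RationalFunctions.

Variables (L : fieldType) (M : nat) (e c : nat -> L).
Hypothesis e_inj : forall i j, (i < M)%N -> (j < M)%N -> e i = e j -> i = j.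

Lemma mup_exp (x : L) (p : {poly L}) n : p != 0 ->
  mup x (p ^+ n) = (n * mup x p)%N.
Proof.
move=> p0; elim: n => [|n IHn].
  by rewrite expr0 mupNroot // rootE hornerC oner_eq0.
by rewrite exprS mupM ?expf_neq0 // IHn.
Qed.

Lemma fraction_coprime (y : {fraction {poly L}}) :
  exists N D : {poly L}, [/\ D != 0, coprimep N D & y = tofrac N / tofrac D].
Proof.
have [[n d] /= d0 yE] : exists2 nd : {poly L} * {poly L}, nd.2 != 0
    & y = tofrac nd.1 / tofrac nd.2.
  exists (\n_(generic_quotient.repr y), \d_(generic_quotient.repr y)); first
    exact: denom_ratioP.
  have d0 : tofrac \d_(generic_quotient.repr y) != 0 by rewrite tofrac_eq0
    denom_ratioP.
  apply: (canRL (mulfK d0)); rewrite -{1}[y]reprK.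
  rewrite !piE; apply/eqmodP; rewrite /= FracField.equivfE /FracField.mulf.
  rewrite !numden_Ratio ?mulf_neq0 ?oner_eq0 ?denom_ratioP //.
  by rewrite !mulr1 mulrC.
exists (n %/ gcdp n d), (d %/ gcdp n d).
have g0 : gcdp n d != 0 by rewrite gcdp_eq0 negb_and d0 orbT.
split.
- by rewrite dvdp_div_eq0 ?dvdp_gcdr.
- by rewrite coprimep_div_gcd // d0 orbT.
rewrite yE; set g := gcdp n d in g0 *.
have -> : tofrac n = tofrac (n %/ g) * tofrac g by rewrite -rmorphM divpK
  ?dvdp_gcdl.
have -> : tofrac d = tofrac (d %/ g) * tofrac g by rewrite -rmorphM divpK
  ?dvdp_gcdr.
by rewrite invfM mulrACA divff ?mulr1 // tofrac_eq0.
Qed.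

(** After clearing denominators, compare multiplicities at [- e i]. Only the factor of index [i]
    vanishes there, so the left side has [n i] plus a multiple of [l], and the right side a multiple
    of [l]. *)
Lemma kummer_indep_frac (l : nat) (n : nat -> nat) (y : {fraction {poly L}}) :
    (0 < l)%N -> (forall i, c i != 0) ->
    \prod_(i < M) tofrac (c i *: ('X + (e i)%:P)) ^+ n i = y ^+ l ->
  forall i, (i < M)%N -> (l %| n i)%N.
Proof.
move=> l_gt0 c0; have [N [D [D0 _ ->]]] := fraction_coprime y => eqy i ltiM.
have X0 j : c j *: ('X + (e j)%:P) != 0.
  by rewrite scaler_eq0 negb_or c0 -size_poly_eq0 size_XaddC.
have {eqy} : (\prod_(j < M) (c j *: ('X + (e j)%:P)) ^+ n j) * D ^+ l = N ^+ l.
  apply/eqP; rewrite -tofrac_eq rmorphM rmorph_prod /=.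
  under eq_bigr do rewrite rmorphXn.
  by rewrite eqy exprMn exprVn -mulrA rmorphXn mulVf ?mulr1 ?rmorphXn //
    expf_neq0 // tofrac_eq0.
have [->|N0] := eqVneq N 0.
  move/eqP; rewrite expr0n gtn_eqF // mulf_eq0 expf_eq0 (negPf D0) andbF orbF
    prodf_seq_eq0.
  by case/hasP => j _; rewrite expf_eq0 (negPf (X0 _)) andbF.
move/(congr1 (mup (- e i))); rewrite mupM ?expf_neq0 //; last first.
  by rewrite prodf_seq_neq0; apply/allP=> j _; rewrite expf_neq0.
rewrite !mup_exp // (bigD1 (Ordinal ltiM)) //= mupM ?expf_neq0 //; last first.
  by rewrite prodf_seq_neq0; apply/allP=> j _; rewrite expf_neq0 ?implybT.
rewrite mup_exp // [mup _ (_ *: _)](_ : _ = 1%N); last first.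
  rewrite -mul_polyC mupMr ?rootC ?c0 //.
  by rewrite -[e i]opprK polyCN opprK (mup_XsubCX 1) eqxx.
rewrite [mup _ (\prod_(_ < _ | _) _)](_ : _ = 0%N); last first.
  apply: mupNroot; rewrite rootE horner_prod prodf_seq_neq0.
  apply/allP => j _; apply/implyP => ji; rewrite hornerE hornerZ.
  rewrite expf_neq0 // mulf_neq0 // !hornerE addrC subr_eq0.
  by apply: contra ji => /eqP /e_inj eji; rewrite -val_eqE /= eji.
rewrite addn0 muln1 => eqn.
by rewrite -(dvdn_addl (n i) (dvdn_mulr (mup (- e i) D) (dvdnn l))) eqn
  dvdn_mulr.
Qed.

(** Compare poles at [- e i]. The left side has at most a simple pole there, whereas a pole of [y]
    would give [y ^+ l - y] a pole of order at least [l]. So [y] is regular at this point and the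
    residue [n i] must vanish in [L]. *)
Lemma artin_schreier_indep_frac (l : nat) (n : nat -> nat)
    (y : {fraction {poly L}}) : prime l -> l \in [pchar L] ->
    \sum_(i < M) (tofrac (c i)%:P + (tofrac ('X + (e i)%:P))^-1) *+ n i
      = y ^+ l - y ->
  forall i, (i < M)%N -> (l %| n i)%N.
Proof.
move=> l_pr lL; have [N [D [D0 coND ->]]] := fraction_coprime y => eqy i ltiM.
have l_gt1 := prime_gt1 l_pr.
pose A j : {poly L} := 'X + (e j)%:P.
have A0 j : A j != 0 by rewrite -size_poly_eq0 size_XaddC.
pose P : {poly L} := \prod_(j < M) A j.
pose Q (j : 'I_M) : {poly L} := \prod_(k < M | k != j) A k.
have PQ (j : 'I_M) : P = A j * Q j by rewrite /P (bigD1 j).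
(* Multiplication by [P * D ^+ l] turns the relation between fractions into one between
   polynomials. *)
have clear (W : fieldType) (t : {rmorphism {poly L} -> W}) :
    (forall p, (t p == 0) = (p == 0)) ->
    \sum_(i < M) (t (c i)%:P + (t (A i))^-1) *+ n i
      = (t N / t D) ^+ l - t N / t D ->
    D ^+ l * \sum_(j < M) ((c j)%:P * P + Q j) *+ n j
      = P * (N ^+ l - N * D ^+ l.-1).
  move=> t_inj eqt; apply/eqP; rewrite -subr_eq0 -t_inj rmorphB subr_eq0.
  have tD0 : t D != 0 by rewrite t_inj.
  have tDl : t D ^+ l = t D * t D ^+ l.-1 by rewrite -exprS prednK // ltnW.
  rewrite !rmorphM rmorphB rmorphM !rmorphXn /= rmorph_sum /=.
  have -> : t N ^+ l - t N * t D ^+ l.-1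
      = t D ^+ l * ((t N / t D) ^+ l - t N / t D).
    rewrite mulrBr exprMn exprVn mulrCA divff ?expf_neq0 // mulr1 tDl.
    by congr (_ - _); field.
  rewrite -eqt [t P * _]mulrCA; apply/eqP; congr (_ * _).
  rewrite mulr_sumr; apply: eq_bigr => j _.
  rewrite rmorphMn /= mulrnAr; congr (_ *+ _).
  rewrite mulrDr rmorphD rmorphM [t P * _]mulrC; congr (_ + _).
  by rewrite (PQ j) rmorphM mulrAC divff ?mul1r // t_inj.
have {clear} eqy := clear _ (@tofrac {poly L}) (@tofrac_eq0 _) eqy.
pose x := - e i; pose i' := Ordinal ltiM.
have Ai : A i = 'X - x%:P by rewrite /x polyCN opprK.
have Px : P.[x] = 0 by rewrite (PQ i') hornerM Ai !hornerE subrr mul0r.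
have Qix : (Q i').[x] != 0.
  rewrite horner_prod prodf_seq_neq0; apply/allP => j _; apply/implyP => ji.
  rewrite !hornerE addrC subr_eq0.
  by apply: contra ji => /eqP /e_inj eji; rewrite -val_eqE /= eji.
have Qjx j : j != i' -> (Q j).[x] = 0.
  move=> ji; rewrite /Q (bigD1 i') 1?eq_sym //= hornerM Ai !hornerE subrr.
  by rewrite mul0r.
have [Dx|Dx] := eqVneq D.[x] 0.
  have Nx : N.[x] != 0.
    by rewrite coprimep_sym in coND; apply: coprimep_root coND _; apply/rootP.
  have [D1 DE] : exists D1, D = D1 * A i.
    by rewrite Ai; apply/factor_theorem/rootP.
  have eq2 : A i * (D1 ^+ l * A i ^+ l.-1
      * \sum_(j < M) ((c j)%:P * P + Q j) *+ n j)
    = A i * (Q i' * (N ^+ l - N * D ^+ l.-1)).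
    have DlE : A i * (D1 ^+ l * A i ^+ l.-1) = D ^+ l.
      by rewrite mulrCA -exprS prednK ?(ltnW l_gt1) // DE exprMn.
    by rewrite !mulrA -(PQ i') -eqy -DlE !mulrA.
  have := congr1 (horner^~ x) (mulfI (A0 i) eq2).
  have l1 : (0 < l.-1)%N by rewrite -ltnS prednK // ltnW.
  rewrite !hornerM hornerD hornerN hornerM !horner_exp Dx Ai hornerXsubC subrr.
  rewrite expr0n gtn_eqF // !mulr0 !mul0r subr0 => /esym/eqP.
  by rewrite mulf_eq0 (negPf Qix) expf_eq0 (negPf Nx) andbF.
have := congr1 (horner^~ x) eqy; rewrite !hornerM Px mul0r horner_exp => /eqP.
rewrite mulf_eq0 expf_eq0 (negPf Dx) andbF /= horner_sum (bigD1 i') //=.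
rewrite hornerMn hornerD hornerM Px mulr0 add0r big1 ?addr0.
  by rewrite -mulr_natr mulf_eq0 (negPf Qix) /= (dvdn_pcharf lL).
by move=> j ji; rewrite hornerMn hornerD hornerM Px mulr0 add0r Qjx // mul0rn.
Qed.

End RationalFunctions.

(** * Independent cyclic covers of the line *)

Lemma irreducible_factor (F : fieldType) (p : {poly F}) : (1 < size p)%N ->
  exists2 r, r %| p & irreducible_poly r.
Proof.
elim: {p}(size p) {-2}p (leqnn (size p)) => [|n IHn] p szp p1.
  by rewrite leqn0 in szp; rewrite (eqP szp) in p1.
case: (classic (irreducible_poly p)) => [irr|nirr]; first by exists p.
have [q [q1 qp nqp]] : exists q : {poly F}, [/\ size q != 1%N, q %| p & ~~ (q
  %= p)].
  apply: NNPP => nex; apply: nirr; split=> // q q1 qp.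
  by apply/idPn => nqp; apply: nex; exists q.
have p0 : p != 0 by rewrite -size_poly_gt0 ltnW.
have q0 : q != 0 by apply: dvdpN0 qp p0.
have ltqp : (size q < size p)%N.
  by rewrite ltn_neqAle dvdp_leq // andbT (dvdp_size_eqp qp).
have leqn : (size q <= n)%N by rewrite -ltnS (leq_trans ltqp).
have q_gt1 : (1 < size q)%N by rewrite ltn_neqAle eq_sym q1 size_poly_gt0.
have [r rq irr] := IHn q leqn q_gt1.
by exists r => //; apply: dvdp_trans rq qp.
Qed.

Lemma split_extension (F : fieldType) (p : {poly F}) : p != 0 ->
  exists (E : fieldExtType F) (rs : seq E),
    map_poly (in_alg E) p %= \prod_(r <- rs) ('X - r%:P).
Proof.
move: {2}_.+1 (ltnSn (size p)) => n; elim: n => // n IHn in F p * => lbn p0.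
have [Cp|C'p] := leqP (size p) 1.
  exists F^o, [::].
  by rewrite big_nil -size_poly_eq1 size_map_poly eqn_leq Cp size_poly_gt0.
have [r r_dv_p irr_r] := irreducible_factor C'p.
have [K _ [x rx0 _]] := irredp_FAdjoin irr_r.
have px0 : root (map_poly (in_alg K) p) x.
  by rewrite -(divpK r_dv_p) rmorphM rootM rx0 orbT.
have [q Dp] := factor_theorem _ _ px0.
have Dszp : size p = size (q * ('X - x%:P)) by rewrite -Dp size_map_poly.
have q0 : q != 0.
  by move: p0; rewrite -size_poly_eq0 Dszp size_poly_eq0 mulf_eq0 => /norP[].
have ltqn : (size q < n)%N.
  by rewrite Dszp size_mul ?polyXsubC_eq0 ?size_XsubC ?addn2 in lbn.
have [E [rs Dq]] := IHn K q ltqn q0.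
exists (baseFieldType E), (x%:A :: rs).
rewrite big_cons; set rhs := _ * _.
suffices -> : map_poly (in_alg (baseFieldType E)) p
    = map_poly (in_alg E) (map_poly (in_alg K) p).
  by rewrite Dp mulrC rmorphM rmorphB /= map_polyX map_polyC eqp_mull.
rewrite -map_poly_comp; apply: eq_map_poly => a /=.
exact: (baseField_scaleE a 1).
Qed.

Lemma extension_with_roots (F : fieldType) (M : nat) (P : nat -> {poly F}) :
    (forall i, (1 < size (P i))%N) ->
  exists (E : fieldExtType F) (rho : nat -> E),
    forall i, (i < M)%N -> root (map_poly (in_alg E) (P i)) (rho i).
Proof.
move=> szP; have prodP0 : \prod_(i < M) P i != 0.
  rewrite prodf_seq_neq0; apply/allP=> i _ /=.
  by rewrite -size_poly_gt0 ltnW.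
have [E [rs eqp]] := split_extension prodP0.
have ex_root i : exists r, (i < M)%N -> root (map_poly (in_alg E) (P i)) r.
  case: (ltnP i M) => [ltiM|_]; last by exists 0.
  have dv : map_poly (in_alg E) (P i) %| \prod_(r <- rs) ('X - r%:P).
    by rewrite -(eqp_dvdr _ eqp) dvdp_map (bigD1 (Ordinal ltiM)) //= dvdp_mulr.
  have [m eqm] := dvdp_prod_XsubC dv.
  have := szP i; rewrite -(size_map_poly (in_alg E)) (eqp_size eqm).
  case: (mask m rs) eqm => [|r s] eqm; first by rewrite big_nil size_poly1.
  by exists r; rewrite (eqp_root eqm) root_prod_XsubC mem_head.
exists E, (fun i => sval (constructive_indefinite_description _ (ex_root i))).
by move=> i; case: constructive_indefinite_description.
Qed.

(* The covers [(T + e_i)(al_i z ^ l - eps z - be_i) = 1] of the line with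
   coordinate [T], for [i < M], are linearly disjoint of degree [l]: successive
   roots [rho i] satisfy no relation of degree less than [l] over the subring
   generated by [T] and the previous roots. *)
Definition independent_cover (L : fieldType) (l M : nat) (e al be : nat -> L)
    (eps : L) : Prop :=
  exists (W : fieldType) (psi : {rmorphism {poly L} -> W}) (rho : nat -> W),
  [/\ forall p, psi p = 0 -> p = 0,
      forall i, (i < M)%N -> psi ('X + (e i)%:P)
        * (psi (al i)%:P * rho i ^+ l - psi eps%:P * rho i - psi (be i)%:P) = 1
    & forall i (P : {poly W}), (i < M)%N ->
        (forall j, adjoin_seq (fun x => exists q, x = psi q) rho i P`_j) ->
        (size P <= l)%N -> P.[rho i] = 0 -> P = 0].

(** The subrings of [adjoin_seq] lie in the fields of [tower], so the degree [l] of [rho i] over its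
    stage excludes shorter relations over the subring. *)
Lemma tower_indep (L F : fieldType) (t : {rmorphism {poly L} -> F})
    (E : fieldExtType F) (rho : nat -> E) (l i : nat) (P : {poly E}) :
    adjoin_degree (tower 1%AS rho i) (rho i) = l ->
    (forall j, adjoin_seq (fun x => exists q, x = (t q)%:A) rho i P`_j) ->
    (size P <= l)%N -> P.[rho i] = 0 -> P = 0.
Proof.
move=> deg BP szP Pi.
have sub j p : adjoin_seq (fun x => exists q, x = (t q)%:A) rho j p ->
    p \in tower 1%AS rho j.
  elim: j p => /= [_ [q ->]|j IHj _ [Q BQ ->]]; first by rewrite rpredZ ?mem1v.
  by apply: mempx_Fadjoin; apply/polyOverP => a; apply: IHj.
apply/eqP; rewrite -(@root_small_adjoin_poly _ _ (tower 1%AS rho i) (rho i)).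
- exact/rootP.
- by apply/polyOverP => a; apply: sub.
- by rewrite deg.
Qed.

Lemma kummer_cover_of (L F : fieldType) (t : {rmorphism {poly L} -> F})
    (l M : nat) (e al : nat -> L) (z : F) :
    prime l -> (forall p, t p = 0 -> p = 0) -> l.-primitive_root z ->
    (forall i, al i != 0) ->
    (forall (n : nat -> nat) y,
      \prod_(i < M) t (al i *: ('X + (e i)%:P)) ^+ n i = y ^+ l ->
      forall i, (i < M)%N -> (l %| n i)%N) ->
  independent_cover l M e al (fun=> 0) 0.
Proof.
move=> l_pr t_inj z_prim al0 indep; have l_gt0 := prime_gt0 l_pr.
pose v i := t (al i *: ('X + (e i)%:P)).
have v0 i : v i != 0.
  apply: contra_neq (al0 i) => /t_inj /eqP.
  by rewrite scaler_eq0 -size_poly_eq0 size_XaddC orbF => /eqP.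
have [|E [rho' rho'P]] := @extension_with_roots F M (fun i => 'X^l - (v
  i)^-1%:P).
  by move=> i; rewrite size_XnsubC // ltnS.
(* The tower lemma constrains all indices; beyond [M] the value [1] is nonzero and has its [l]-th
   power in the base. *)
pose rho i := if (i < M)%N then rho' i else 1.
have rhol i : (i < M)%N -> rho i ^+ l = (v i)^-1%:A.
  move=> ltiM; rewrite /rho ltiM; move: (rho'P i ltiM).
  rewrite rmorphB /= map_polyXn map_polyC rootE !hornerE subr_eq0.
  by move/eqP.
have rho0 i : rho i != 0.
  have [ltiM|leMi] := ltnP i M; last by rewrite /rho ltnNge leMi oner_eq0.
  apply: contra_neq (v0 i) => ri; have := rhol i ltiM; rewrite ri expr0n
    gtn_eqF //.
  by move/esym/eqP; rewrite -in_algE fmorph_eq0 invr_eq0 => /eqP.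
have deg i : (i < M)%N -> adjoin_degree (tower 1%AS rho i) (rho i) = l.
  apply: (@kummer_tower_degree _ _ _ l_pr _ _ z%:A).
  - by rewrite (fmorph_primitive_root (in_alg E)).
  - by rewrite rpredZ ?mem1v.
  - move=> j; split; first exact: rho0.
    have [ltjM|leMj] := ltnP j M; first by rewrite rhol // rpredZ ?mem1v.
    by rewrite /rho ltnNge leMj expr1n mem1v.
  - move=> n _ /vlineP[y ->]; rewrite big_mkord => eqn.
    (* Since [rho j ^+ l] is the inverse of [v j], the relation at hand is the inverse of the one in
       [indep]. *)
    apply: (indep n y^-1); apply: (fmorph_inj (in_alg E)).
    rewrite rmorph_prod rmorphXn fmorphV exprVn -eqn -prodfV.
    apply: eq_bigr => j _; rewrite exprM rhol // -in_algE fmorphV.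
    by rewrite -exprVn invrK rmorphXn.
exists E, (in_alg E \o t), rho; split.
- by move=> p /= /eqP; rewrite -in_algE fmorph_eq0 => /eqP; apply: t_inj.
- move=> i ltiM; rewrite !raddf0 mul0r !subr0 addr0 rhol //.
  transitivity (in_alg E (t ('X + (e i)%:P) * (t (al i)%:P * (v i)^-1))).
    by rewrite !rmorphM.
  by rewrite mulrA -rmorphM mulrC [_ * (al i)%:P]mulrC mul_polyC mulVf ?rmorph1.
- move=> i P ltiM; apply: tower_indep; exact: deg.
Qed.

Lemma artin_schreier_cover_of (L F : fieldType) (t : {rmorphism {poly L} -> F})
    (l M : nat) (e be : nat -> L) :
    prime l -> l \in [pchar L] -> (forall p, t p = 0 -> p = 0) ->
    (forall (n : nat -> nat) y,
      \sum_(i < M) (t (be i)%:P + (t ('X + (e i)%:P))^-1) *+ n i = y ^+ l - y ->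
      forall i, (i < M)%N -> (l %| n i)%N) ->
  independent_cover l M e (fun=> 1) be 1.
Proof.
move=> l_pr lL t_inj indep; have l_gt1 := prime_gt1 l_pr.
pose v i := t (be i)%:P + (t ('X + (e i)%:P))^-1.
have lF : l \in [pchar F].
  by rewrite (rmorph_pchar t) // (rmorph_pchar (@polyC L)).
have [|E [rho' rho'P]] := @extension_with_roots F M (fun i => 'X^l - 'X - (v
  i)%:P).
  by move=> i; rewrite artin_schreier_size // ltnS ltnW.
have lE : l \in [pchar E] by rewrite (rmorph_pchar (in_alg E)).
pose rho i := if (i < M)%N then rho' i else 0.
have rhol i : (i < M)%N -> rho i ^+ l - rho i = (v i)%:A.
  move=> ltiM; rewrite /rho ltiM; move: (rho'P i ltiM).
  rewrite !rmorphB /= map_polyXn map_polyX map_polyC rootE !hornerE subr_eq0.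
  by move/eqP.
have deg i : (i < M)%N -> adjoin_degree (tower 1%AS rho i) (rho i) = l.
  apply: artin_schreier_tower_degree => //.
  - move=> j; have [ltjM|leMj] := ltnP j M; first by rewrite rhol // rpredZ
    ?mem1v.
    by rewrite /rho ltnNge leMj expr0n gtn_eqF ?subr0 ?mem0v // ltnW.
  - move=> n _ /vlineP[y ->]; rewrite big_mkord => eqn.
    apply: (indep n y); apply: (fmorph_inj (in_alg E)).
    rewrite rmorph_sum rmorphB rmorphXn -eqn.
    by apply: eq_bigr => j _; rewrite rhol // rmorphMn.
exists E, (in_alg E \o t), rho; split.
- by move=> p /= /eqP; rewrite -in_algE fmorph_eq0 => /eqP; apply: t_inj.
- move=> i ltiM; rewrite !rmorph1 !mul1r rhol //.
  transitivity (in_alg E (t ('X + (e i)%:P) * (v i - t (be i)%:P))).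
    by rewrite rmorphM rmorphB.
  rewrite /v [t _ + _]addrC addrK divff ?rmorph1 //.
  apply: contraTneq isT => /t_inj/eqP.
  by rewrite -size_poly_eq0 size_XaddC.
- move=> i P ltiM; apply: tower_indep; exact: deg.
Qed.

(** * Restriction of scalars *)

(** One shape for both kinds of cover, with ['X] in the place of [theta]. Kummer covers have
    [eps = 0], [B = 0] and twist [A]; Artin-Schreier covers have [eps = 1], [A = 1] and twist
    [B]. *)
Definition cover_eq (R : comNzRingType) (l : nat) (t e eps : R)
    (A B h : {poly R}) : {poly R} :=
  ('X + (t + e)%:P) * (A * h ^+ l - eps%:P * h - B) - 1.

Lemma map_cover_eq (R R' : comNzRingType) (phi : {rmorphism R -> R'})
    (l : nat) (t e eps : R) (A B h : {poly R}) :
  map_poly phi (cover_eq l t e eps A B h)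
  = cover_eq l (phi t) (phi e) (phi eps)
      (map_poly phi A) (map_poly phi B) (map_poly phi h).
Proof.
by rewrite /cover_eq !(rmorphB, rmorphM, rmorphD, rmorph1, rmorphXn) /=
  !(map_polyX, map_polyC) /= ?rmorphD.
Qed.

Lemma horner_cover_eq (R : comNzRingType) (l : nat) (t e eps : R)
    (A B h : {poly R}) (x : R) :
  (cover_eq l t e eps A B h).[x]
  = (x + (t + e)) * (A.[x] * h.[x] ^+ l - eps * h.[x] - B.[x]) - 1.
Proof. by rewrite /cover_eq !(hornerE, horner_exp). Qed.

Section Restriction.

Variables (k : fieldType) (g : {poly k}) (D m l : nat).
Variables (e : nat -> k) (al be : nat -> {poly k}) (eps : k).
Hypotheses (g_monic : g \is monic) (g_sep : separable_poly g).
Hypothesis size_g : size g = D.+2.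
Hypothesis l_gt1 : (1 < l)%N.
Hypothesis al_coprime : forall j, coprimep g (al j).
(** An index [x < m * D.+1] encodes a pair: the equation [x %/ D.+1] and the root [x %% D.+1] of
    [g]. *)
Hypothesis cover : forall (L : closedFieldType) (i : {rmorphism k -> L})
    (th : nat -> L),
  map_poly i g = \prod_(s < D.+1) ('X - (th s)%:P) ->
  independent_cover l (m * D.+1) (fun x => th (x %% D.+1)%N + i (e (x %/
    D.+1)%N))
    (fun x => (map_poly i (al (x %/ D.+1)%N)).[th (x %% D.+1)%N])
    (fun x => (map_poly i (be (x %/ D.+1)%N)).[th (x %% D.+1)%N]) (i eps).

(* Coordinates of the restriction of scalars: [wvar 0] is the parameter [t] and
   [wvar (j * D.+1 + c).+1] is the coefficient of ['X^c] in the unknown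
   [wpoly j], which stands for an element of [k[X]/g]; the equations [weqs] say
   that the remainders [wrem j] modulo [g] vanish. *)
Let nvars := (m * D.+1).+1.

Definition wvar (R : comNzRingType) (v : nat) : {mpoly R[nvars]} := 'X_(inord
  v).

Definition wpoly (R : comNzRingType) (j : nat) : {poly {mpoly R[nvars]}} :=
  \poly_(c < D.+1) wvar R (j * D.+1 + c).+1.

Definition weq (R : fieldType) (i : {rmorphism k -> R}) (j : nat) :
    {poly {mpoly R[nvars]}} :=
  cover_eq l (wvar R 0) (i (e j))%:MP (i eps)%:MP
    (map_poly (@mpolyC nvars R) (map_poly i (al j)))
    (map_poly (@mpolyC nvars R) (map_poly i (be j))) (wpoly R j).

Let gC := map_poly (@mpolyC nvars k) g.

Let gC_monic : gC \is monic.
Proof. exact: monic_map. Qed.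

Definition wrem (j : nat) := Pdiv.Ring.rmodp (weq idfun j) gC.

Let wrem_eq j : exists q, weq idfun j = q * gC + wrem j.
Proof. by exists (Pdiv.Ring.rdivp (weq idfun j) gC); apply:
  Pdiv.RingMonic.rdivp_eq. Qed.

Let size_wrem j : (size (wrem j) <= D.+1)%N.
Proof.
have szgC : size gC = D.+2.
  by rewrite size_map_poly_id0 ?size_g // (monicP g_monic) rmorph1 oner_eq0.
by rewrite -ltnS -szgC Pdiv.Ring.ltn_rmodpN0 ?monic_neq0.
Qed.

Definition weqs : seq {mpoly k[nvars]} :=
  [seq (wrem j)`_c | j <- iota 0 m, c <- iota 0 D.+1].

Let mem_weqs j c : (j < m)%N -> (c < D.+1)%N -> (wrem j)`_c \in weqs.
Proof.
move=> ltjm ltcD; apply/allpairsP; exists (j, c).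
by rewrite !mem_iota /= !add0n.
Qed.

Lemma weqs_point (x : 'I_nvars -> k) : rational_point weqs x ->
  exists t (h : nat -> {poly k}), forall j, (j < m)%N ->
    g %| cover_eq l t (e j) eps (al j) (be j) (h j).
Proof.
move=> xP; exists (x ord0), (fun j => map_poly (meval x) (wpoly k j)).
move=> j ltjm; have [q qE] := wrem_eq j.
have mapC (p : {poly k}) : map_poly (meval x) (map_poly (@mpolyC nvars k) p) =
  p.
  by rewrite -map_poly_comp map_poly_id // => c _ /=; apply: mevalC.
have r0 : map_poly (meval x) (wrem j) = 0.
  apply/polyP=> c; rewrite coef_map coef0.
  have [ltcD|leDc] := ltnP c D.+1; first exact/xP/mem_weqs.
  by rewrite nth_default ?raddf0 //; apply: leq_trans leDc.
have : map_poly (meval x) (weq idfun j) = map_poly (meval x) q * g.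
  by rewrite qE rmorphD rmorphM /= r0 addr0 mapC.
rewrite /weq map_cover_eq !mapC /= !mevalC !(map_poly_id (g := idfun)) //.
rewrite mevalXU (_ : inord 0 = ord0); last by apply: val_inj; rewrite /= inordK.
by move=> ->; apply: dvdp_mull.
Qed.

Section BaseChange.

Variables (L : closedFieldType) (i : {rmorphism k -> L}).

Let I := ideal_generated [seq map_mpoly i f | f <- weqs].
Let hI : ideal_pred I := ideal_generated_pred _.

Variable th : nat -> L.
Hypothesis gE : map_poly i g = \prod_(s < D.+1) ('X - (th s)%:P).

(** The subring [L[t]], over which the values [Z] will be adjoined one by one. *)
Let B0 (p : {mpoly L[nvars]}) : Prop :=
  exists q : {poly L}, p = (map_poly (@mpolyC nvars L) q).[wvar L 0].

Let Z (x : nat) : {mpoly L[nvars]} :=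
  (wpoly L (x %/ D.+1)).[(th (x %% D.+1)%N)%:MP].

Let map_mpoly_wvar v : map_mpoly i (wvar k v) = wvar L v.
Proof. exact: map_mpolyX. Qed.

Let map_wpoly j : map_poly (map_mpoly i) (wpoly k j) = wpoly L j.
Proof.
apply/polyP=> c; rewrite coef_map !coef_poly; case: ifP => _.
  exact: map_mpolyX.
exact: rmorph0.
Qed.

Let map_mpolyCC (p : {poly k}) :
  map_poly (map_mpoly i) (map_poly (@mpolyC nvars k) p)
  = map_poly (@mpolyC nvars L) (map_poly i p).
Proof.
by rewrite -!map_poly_comp; apply: eq_map_poly => c /=; apply: map_mpolyC.
Qed.

Let map_weq j : map_poly (map_mpoly i) (weq idfun j) = weq i j.
Proof.
rewrite /weq map_cover_eq map_wpoly !map_mpolyCC /= map_mpoly_wvar !map_mpolyC.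
by rewrite !(map_poly_id (g := idfun)).
Qed.

Let weq_rem x : (x < m * D.+1)%N ->
  (weq i (x %/ D.+1)).[(th (x %% D.+1)%N)%:MP]
  = (map_poly (map_mpoly i) (wrem (x %/ D.+1))).[(th (x %% D.+1)%N)%:MP].
Proof.
move=> ltx; set j := (x %/ D.+1)%N; set s := (x %% D.+1)%N.
have [q qE] := wrem_eq j; rewrite -map_weq qE rmorphD rmorphM /= map_mpolyCC gE.
rewrite hornerD hornerM.
have -> : (map_poly (@mpolyC nvars L) (\prod_(s < D.+1) ('X - (th s)%:P))).[(th
  s)%:MP] = 0.
  have lts : (s < D.+1)%N by rewrite ltn_mod.
  by rewrite horner_map horner_prod (bigD1 (Ordinal lts)) //= !hornerE subrr
    mul0r mpolyC0.
by rewrite mulr0 add0r.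
Qed.

Let weq_root x : (x < m * D.+1)%N ->
  I (weq i (x %/ D.+1)).[(th (x %% D.+1)%N)%:MP].
Proof.
move=> ltx; rewrite weq_rem //.
have ltjm : (x %/ D.+1 < m)%N by rewrite ltn_divLR.
apply: ideal_horner => // c; rewrite coef_map.
have [ltcD|leDc] := ltnP c D.+1.
  by apply: ideal_generated_mem; apply/map_f/mem_weqs.
by rewrite nth_default ?raddf0; [apply: ideal0|apply: leq_trans leDc].
Qed.

Let th_inj s s' : (s < D.+1)%N -> (s' < D.+1)%N -> th s = th s' -> s = s'.
Proof.
move=> lts lts' ss'.
have : uniq [seq th s | s <- iota 0 D.+1].
  rewrite -separable_prod_XsubC big_map -[iota _ _]/(index_iota 0 D.+1).
  by rewrite big_mkord -gE separable_map.
move/(uniqP 0)/(_ s s'); rewrite !inE size_map size_iota => /(_ lts lts').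
by rewrite !(nth_map 0%N) ?size_iota // !nth_iota ?add0n //; apply.
Qed.

(* The Vandermonde matrix of the roots of [g] changes the coefficients of
   [wpoly j] into its values [Z] at these roots, which are the coordinates in
   which the covers separate. *)
Let V : 'M[L]_D.+1 := Vandermonde D.+1 (\row_s th s).

Let V_unit : V \in unitmx.
Proof.
rewrite unitmxE det_Vandermonde unitfE prodf_seq_neq0; apply/allP => a _ /=.
rewrite prodf_seq_neq0; apply/allP => b _; apply/implyP => ltab.
rewrite !mxE subr_eq0; apply/eqP => /th_inj ba.
by rewrite ba ?ltnn in ltab.
Qed.

Let ZE x : Z x
  = \sum_(c < D.+1) (V c (inord (x %% D.+1)))%:MP * wvar L (x %/ D.+1 * D.+1 +
    c).+1.
Proof.
rewrite /Z /wpoly horner_poly; apply: eq_bigr => c _.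
by rewrite mulrC !mxE inordK ?ltn_mod // rmorphXn.
Qed.

Let wvarE j (c : 'I_D.+1) : wvar L (j * D.+1 + c).+1
  = \sum_(s < D.+1) (invmx V s c)%:MP * Z (j * D.+1 + s).
Proof.
under eq_bigr => s _.
  rewrite ZE divnMDl // modnMDl (modn_small (ltn_ord s)) divn_small ?ltn_ord //.
  rewrite addn0 inord_val mulr_sumr.
  under eq_bigr do rewrite mulrA -mpolyCM [_ * V _ _]mulrC.
  over.
rewrite exchange_big /=.
under eq_bigr => c' _ do rewrite -mulr_suml -raddf_sum.
transitivity (\sum_(c' < D.+1) ((V *m invmx V) c' c)%:MP * wvar L (j * D.+1 +
  c').+1).
  rewrite mulmxV // (bigD1 c) //= mxE eqxx mul1r big1 ?addr0 // => c' c'c.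
  by rewrite mxE (negPf c'c) mpolyC0 mul0r.
by apply: eq_bigr => c' _; rewrite mxE.
Qed.

Let weqZ x : (weq i (x %/ D.+1)).[(th (x %% D.+1)%N)%:MP]
  = ((th (x %% D.+1)%N)%:MP + (wvar L 0 + (i (e (x %/ D.+1)%N))%:MP))
    * (((map_poly i (al (x %/ D.+1)%N)).[th (x %% D.+1)%N])%:MP * Z x ^+ l
       - (i eps)%:MP * Z x
       - ((map_poly i (be (x %/ D.+1)%N)).[th (x %% D.+1)%N])%:MP) - 1.
Proof. by rewrite /weq horner_cover_eq -/(Z x) !horner_map. Qed.

Let al_neq0 j s : (s < D.+1)%N -> (map_poly i (al j)).[th s] != 0.
Proof.
move=> lts; have : coprimep (map_poly i g) (map_poly i (al j)).
  by rewrite coprimep_map.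
move/coprimep_root; apply; apply/rootP.
by rewrite gE horner_prod (bigD1 (Ordinal lts)) //= !hornerE subrr mul0r.
Qed.

Let hB0 : subring_pred B0.
Proof.
split=> [||_ _ [p ->] [q ->]|_ _ [p ->] [q ->]].
- by exists 0; rewrite rmorph0 horner0.
- by exists 1; rewrite rmorph1 hornerC.
- by exists (p + q); rewrite rmorphD hornerD.
- by exists (p * q); rewrite rmorphM hornerM.
Qed.

Let B0_const c : B0 c%:MP.
Proof. by exists c%:P; rewrite map_polyC hornerC. Qed.

Let B0_wvar : B0 (wvar L 0).
Proof. by exists 'X; rewrite map_polyX hornerX. Qed.

(** By [wvarE], every variable other than [t] is a linear combination of the values [Z] in its
    block. *)
Let adjoin_seq_full p : adjoin_seq B0 Z (m * D.+1) p.
Proof.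
have hB := adjoin_seq_subring Z hB0 (m * D.+1).
have incl q : B0 q -> adjoin_seq B0 Z (m * D.+1) q.
  by apply: (@adjoin_seq_le _ _ Z hB0 0).
elim/mpolyind: p => [|c mon p _ _ IHp]; first exact: subring0.
apply: subringD => //; rewrite -mul_mpolyC; apply: subringM => //.
  exact/incl/B0_const.
rewrite mpolyXE_id; elim/big_ind: _ => [|a b|v _]; first exact: subring1.
  exact: subringM.
apply: subring_exp => //.
have -> : 'X_v = wvar L v by rewrite /wvar inord_val.
case: v => [[|v] /= ltv]; first exact/incl/B0_wvar.
have D1 : (v %% D.+1 < D.+1)%N by rewrite ltn_mod.
rewrite {1}(divn_eq v D.+1) (wvarE _ (Ordinal D1)).
apply: subring_sum => // s _; apply: subringM => //; first exact/incl/B0_const.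
apply: adjoin_seq_gen => //.
have : ((v %/ D.+1).+1 * D.+1 <= m * D.+1)%N.
  by rewrite leq_mul2r ltn_divLR.
by apply: leq_trans; rewrite mulSn addnC ltn_add2r.
Qed.

Lemma weqs_prime : prime_ideal I.
Proof.
have [W [psi [rho [psi_inj rhoE indep]]]] := cover gE.
(* The images of the variables are forced by the requirement that [Z x] go to [rho x]: the inverse
   Vandermonde matrix recovers the coefficients from the values at the roots. *)
pose hv (v : 'I_nvars) : W := if v == 0%N :> nat then psi 'X else
  \sum_(s < D.+1) psi (invmx V s (inord (v.-1 %% D.+1)))%:P
    * rho (v.-1 %/ D.+1 * D.+1 + s)%N.
pose phi : {rmorphism {mpoly L[nvars]} -> W} :=
  mmap (psi \o @polyC L) hv.
have phiC c : phi c%:MP = psi c%:P by rewrite /phi /= mmapC.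
have phi0 : phi (wvar L 0) = psi 'X.
  by rewrite /phi /= mmapX mmap1U /hv inordK.
have phiV j (c : 'I_D.+1) : (j < m)%N -> phi (wvar L (j * D.+1 + c).+1)
    = \sum_(s < D.+1) psi (invmx V s c)%:P * rho (j * D.+1 + s)%N.
  move=> ltjm; rewrite /phi /= mmapX mmap1U /hv inordK /=.
    rewrite divnMDl // modnMDl (modn_small (ltn_ord c)) divn_small ?ltn_ord //.
    by rewrite addn0 inord_val.
  rewrite ltnS; have : (j.+1 * D.+1 <= m * D.+1)%N by rewrite leq_mul2r ltjm.
  by apply: leq_trans; rewrite mulSn addnC ltn_add2r.
have phiZ x : (x < m * D.+1)%N -> phi (Z x) = rho x.
  move=> ltx; have ltjm : (x %/ D.+1 < m)%N by rewrite ltn_divLR.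
  rewrite ZE rmorph_sum /=; set s0 := inord _.
  under eq_bigr => c _.
    rewrite rmorphM phiC phiV // mulr_sumr.
    under eq_bigr do rewrite mulrA -rmorphM -polyCM [V _ _ * _]mulrC.
    over.
  rewrite exchange_big /=.
  under eq_bigr => s _ do rewrite -mulr_suml -!raddf_sum.
  transitivity (\sum_(s < D.+1) psi ((invmx V *m V) s s0)%:P
      * rho (x %/ D.+1 * D.+1 + s)%N).
    by apply: eq_bigr => s _; rewrite mxE.
  rewrite mulVmx // (bigD1 s0) //= mxE eqxx rmorph1 mul1r big1 ?addr0.
    by rewrite /s0 inordK ?ltn_mod // -divn_eq.
  by move=> s ss0; rewrite mxE (negPf ss0) !raddf0 mul0r.
have phi_weq x : (x < m * D.+1)%N ->
    phi (weq i (x %/ D.+1)).[(th (x %% D.+1)%N)%:MP] = 0.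
  move=> ltx; rewrite weqZ rmorphB rmorphM !rmorphB !rmorphM !rmorphD rmorph1.
  rewrite rmorphXn !phiC phi0 phiZ // -(rhoE x ltx) polyCD !rmorphD.
  by rewrite [psi 'X + _]addrCA subrr.
(* The image of a remainder has degree at most [D] and vanishes at the images of the [D.+1] distinct
   roots of [g]. So [phi] kills its coefficients, which generate [I]. *)
have phi_wrem j : (j < m)%N ->
    map_poly phi (map_poly (map_mpoly i) (wrem j)) = 0.
  move=> ltjm; apply: (@roots_geq_poly_eq0 _ _ [seq psi (th s)%:P | s <- iota 0
    D.+1]).
  - apply/allP => _ /mapP[s + ->]; rewrite mem_iota add0n /= => lts.
    have ltx : (j * D.+1 + s < m * D.+1)%N.
      have : (j.+1 * D.+1 <= m * D.+1)%N by rewrite leq_mul2r ltjm.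
      by apply: leq_trans; rewrite mulSn addnC ltn_add2r.
    have := phi_weq _ ltx; rewrite weq_rem // divnMDl // modnMDl.
    rewrite (modn_small lts) divn_small // addn0 -horner_map phiC.
    by move/rootP.
  - rewrite map_inj_in_uniq ?iota_uniq // => s s'.
    rewrite !mem_iota !add0n /= => lts lts' /eqP; rewrite -subr_eq0 -rmorphB.
    move/eqP/psi_inj/eqP; rewrite -polyCB polyC_eq0 subr_eq0 => /eqP.
    exact: th_inj.
  - rewrite size_map size_iota (leq_trans (size_poly _ _)) //.
    by rewrite (leq_trans (size_poly _ _)) // size_wrem.
have phiI p : I p -> phi p = 0.
  case=> c ->; rewrite rmorph_sum big1 // => a _; rewrite rmorphM.
  have : [seq map_mpoly i f | f <- weqs]`_a \in [seq map_mpoly i f | f <- weqs].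
    by rewrite mem_nth.
  case/mapP=> f /allpairsP[[j d] /=]; rewrite !mem_iota !add0n /=.
  case=> ltjm _ -> ->.
  have := congr1 (fun r : {poly W} => r`_d) (phi_wrem j ltjm).
  by rewrite !coef_map coef0 /= => ->; rewrite mulr0.
have phiB0 q : phi (map_poly (@mpolyC nvars L) q).[wvar L 0] = psi q.
  rewrite -horner_map phi0 -map_poly_comp /=.
  elim/poly_ind: q => [|q c IHq]; first by rewrite !raddf0 horner0.
  rewrite rmorphD rmorphM /= map_polyX map_polyC hornerMXaddC IHq /=.
  by rewrite phiC rmorphD rmorphM.
apply: (@adjoin_seq_prime _ B0 Z hB0 I hI W phi phiI l (m * D.+1)).
- by move=> _ [q ->]; rewrite phiB0 => /psi_inj ->; rewrite rmorph0 horner0;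
  apply: ideal0.
- move=> x ltx; set a := (map_poly i (al (x %/ D.+1)%N)).[th (x %% D.+1)%N].
  set b := (map_poly i (be (x %/ D.+1)%N)).[th (x %% D.+1)%N].
  pose T := (th (x %% D.+1)%N)%:MP + (wvar L 0 + (i (e (x %/ D.+1)%N))%:MP).
  have BT : B0 T by do 2! apply: subringD => //; apply: B0_const.
  exists (T * a%:MP), (((T * (i eps)%:MP) *: 'X + (T * b%:MP + 1)%:P)).
  have := weq_root ltx; rewrite weqZ -/a -/b -/T => IT.
  split.
  + by apply: subringM => //; apply: B0_const.
  (* The equation exhibits an inverse of [T] modulo [I], and [a] is a nonzero constant since [al] is
     coprime to [g]. *)
  + exists (a^-1%:MP * (a%:MP * Z x ^+ l - (i eps)%:MP * Z x - b%:MP)).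
    rewrite mulrA -[T * _ * _]mulrA -mpolyCM divff ?al_neq0 ?ltn_mod //.
    by rewrite mpolyC1 mulr1.
  + move=> c; rewrite coefD coefZ coefX coefC; apply: subringD => //.
      apply: subringM => //; first by apply: subringM => //; apply: B0_const.
      by case: (_ == _); [apply: subring1|apply: subring0].
    case: (_ == _); last exact: subring0.
    by apply: subringD => //; [apply: subringM => //; apply: B0_const|apply:
      subring1].
  + rewrite (leq_trans (size_polyD _ _)) // geq_max.
    rewrite (leq_trans (size_scale_leq _ _)) ?size_polyX //.
    by rewrite (leq_trans (size_polyC_leq1 _)) // ltnW.
  + move: IT; congr I; rewrite hornerD hornerZ hornerX hornerC; ring.
- move=> x P ltx BP szP Px0 c.
  have sub y p : (y <= m * D.+1)%N -> adjoin_seq B0 Z y p ->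
      adjoin_seq (fun x => exists q, x = psi q) rho y (phi p).
    elim: y p => /= [_ _ [q ->]|y IHy _ lty [Q BQ ->]].
      by exists q; rewrite phiB0.
    exists (map_poly phi Q); last by rewrite -horner_map /= phiZ.
    by move=> d; rewrite coef_map; apply: IHy => //; apply: ltnW.
  have := indep x (map_poly phi P) ltx; rewrite phiZ // in Px0 *.
  move=> /(_ _ _ Px0) P0; rewrite -coef_map P0 ?coef0 //.
    by move=> d; rewrite coef_map; apply: sub => //; apply: ltnW.
  by rewrite (leq_trans (size_poly _ _)).
- exact: adjoin_seq_full.
Qed.

End BaseChange.

Theorem weqs_absolutely_irreducible : absolutely_irreducible weqs.
Proof.
move=> L i _; have [rs rsE] := closed_field_poly_normal (map_poly i g).
rewrite (monicP (monic_map i g_monic)) scale1r in rsE.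
have szrs : size rs = D.+1.
  apply: succn_inj; rewrite -size_g -(size_map_poly i) rsE.
  by rewrite size_prod_XsubC.
apply: (@weqs_prime L i (nth 0 rs)); rewrite rsE (big_nth 0) szrs.
by rewrite big_mkord.
Qed.

Theorem pac_cover_point : pseudo_algebraically_closed k ->
  exists t (h : nat -> {poly k}), forall j, (j < m)%N ->
    g %| cover_eq l t (e j) eps (al j) (be j) (h j).
Proof.
by move=> pac; have [x /weqs_point] := pac _ _ weqs_absolutely_irreducible.
Qed.

End Restriction.

(** * Points of the covers over a PAC field *)

Lemma separable_XnsubC1 (L : fieldType) (l : nat) :
  (1 < l)%N -> (l%:R != 0 :> L) -> separable_poly ('X^l - 1 : {poly L}).
Proof.
move=> l_gt1 l0; rewrite separable_poly.unlock derivB derivXn derivC subr0.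
rewrite -scaler_nat coprimepZr // coprimep_expr // coprimepX rootE !hornerE.
by rewrite expr0n gtn_eqF ?(ltnW l_gt1) // sub0r oppr_eq0 oner_eq0.
Qed.

Lemma prim_root_split (L : fieldType) (l : nat) (rs : seq L) :
    (1 < l)%N -> (l%:R != 0 :> L) -> 'X^l - 1 %= \prod_(r <- rs) ('X - r%:P) ->
  has l.-primitive_root rs.
Proof.
move=> l_gt1 l0 eqp; have l_gt0 := ltnW l_gt1.
have szrs : size rs = l.
  apply: succn_inj; rewrite -(size_prod_XsubC rs id) -(eqp_size eqp).
  by rewrite size_XnsubC.
apply: has_prim_root => //; last by rewrite szrs.
  apply/allP => r rrs; rewrite unity_rootE.
  have : root ('X^l - 1) r by rewrite (eqp_root eqp) root_prod_XsubC.
  by rewrite rootE !hornerE subr_eq0.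
rewrite -separable_prod_XsubC -(eqp_separable eqp).
exact: separable_XnsubC1.
Qed.

Lemma kummer_cover (L : closedFieldType) (l M : nat) (e al be : nat -> L) :
    prime l -> (l%:R != 0 :> L) ->
    (forall i j, (i < M)%N -> (j < M)%N -> e i = e j -> i = j) ->
    (forall i, al i != 0) -> (forall i, be i = 0) ->
  independent_cover l M e al be 0.
Proof.
move=> l_pr l0 e_inj al0 be0; have l_gt0 := prime_gt0 l_pr.
have -> : be = fun=> 0 by apply: functional_extensionality.
have [rs rsE] := closed_field_poly_normal ('X^l - 1 : {poly L}).
have mon : 'X^l - 1 \is @monic L by rewrite -polyC1 monicXnsubC.
rewrite (monicP mon) scale1r in rsE.
have : has l.-primitive_root rs by apply: prim_root_split; rewrite ?prime_gt1
  // -rsE eqpxx.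
case/hasP => z _ z_prim.
apply: (@kummer_cover_of L _ (@tofrac {poly L}) l M e al (tofrac z%:P)) => //.
- by move=> p /eqP; rewrite tofrac_eq0 => /eqP.
- rewrite -[tofrac _]/((@tofrac {poly L} \o @polyC L) z).
  by rewrite fmorph_primitive_root.
- by move=> n y; apply: kummer_indep_frac.
Qed.

Lemma artin_schreier_cover (L : fieldType) (l M : nat) (e al be : nat -> L)
    (eps : L) :
    prime l -> l \in [pchar L] ->
    (forall i j, (i < M)%N -> (j < M)%N -> e i = e j -> i = j) ->
    (forall i, al i = 1) -> eps = 1 ->
  independent_cover l M e al be eps.
Proof.
move=> l_pr lL e_inj al1 ->.
have -> : al = fun=> 1 by apply: functional_extensionality.
apply: (@artin_schreier_cover_of L _ (@tofrac {poly L})) => //.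
- by move=> p /eqP; rewrite tofrac_eq0 => /eqP.
- by move=> n y; apply: artin_schreier_indep_frac.
Qed.

Section PacCovers.

Variables (k : fieldType) (k_pac : pseudo_algebraically_closed k).
Variables (g : {poly k}) (m l : nat) (e : nat -> k).
Hypotheses (g_monic : g \is monic) (g_sep : separable_poly g).
Hypothesis g_gt1 : (1 < size g)%N.
Hypothesis l_pr : prime l.
(** This expresses, without reference to the roots, that [e i - e j] is not a difference of two
    roots of [g]. *)
Hypothesis shift_coprime : forall i j, (i < m)%N -> (j < m)%N -> i != j ->
  coprimep g (g \Po ('X + (e i - e j)%:P)).

Let D := (size g).-2.

Let size_g : size g = D.+2.
Proof. by rewrite /D; case: (size g) g_gt1 => [|[]]. Qed.

(** The branch points are pairwise distinct: separability of [g] separates those of one equation,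
    and coprimality of the shifts those of two different equations. *)
Let shift_inj (L : closedFieldType) (i : {rmorphism k -> L}) (th : nat -> L) :
  map_poly i g = \prod_(s < D.+1) ('X - (th s)%:P) ->
  forall x y, (x < m * D.+1)%N -> (y < m * D.+1)%N ->
    th (x %% D.+1)%N + i (e (x %/ D.+1)%N)
    = th (y %% D.+1)%N + i (e (y %/ D.+1)%N) -> x = y.
Proof.
move=> gE x y ltx lty.
have th_root s : (s < D.+1)%N -> root (map_poly i g) (th s).
  move=> lts; apply/rootP.
  by rewrite gE horner_prod (bigD1 (Ordinal lts)) //= !hornerE subrr mul0r.
have th_inj s s' : (s < D.+1)%N -> (s' < D.+1)%N -> th s = th s' -> s = s'.
  move=> lts lts' ss'.
  have : uniq [seq th s | s <- iota 0 D.+1].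
    rewrite -separable_prod_XsubC big_map -[iota _ _]/(index_iota 0 D.+1).
    by rewrite big_mkord -gE separable_map.
  move/(uniqP 0)/(_ s s'); rewrite !inE size_map size_iota => /(_ lts lts').
  by rewrite !(nth_map 0%N) ?size_iota // !nth_iota ?add0n //; apply.
set j := (x %/ _)%N; set j' := (y %/ _)%N; set s := (x %% _)%N; set s' := (y %%
  _)%N.
have [lts lts'] : (s < D.+1)%N /\ (s' < D.+1)%N by rewrite !ltn_mod.
have [ltj ltj'] : (j < m)%N /\ (j' < m)%N by rewrite !ltn_divLR.
move=> eqs; have [jj'|nj] := eqVneq j j'.
  have ss' : s = s' by apply: th_inj => //; move: eqs; rewrite jj' => /addIr.
  by rewrite (divn_eq x D.+1) (divn_eq y D.+1) -/j -/j' -/s -/s' jj' ss'.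
have := shift_coprime ltj ltj' nj; rewrite -(coprimep_map i).
move/coprimep_root/(_ (th_root s lts)); rewrite map_comp_poly horner_comp.
rewrite rmorphD /= map_polyX map_polyC !hornerE raddfB addrA eqs addrK.
by have := th_root s' lts'; rewrite rootE => ->.
Qed.

Lemma pac_kummer (al : nat -> {poly k}) : (l%:R != 0 :> k) ->
    (forall j, coprimep g (al j)) ->
  exists t (h : nat -> {poly k}), forall j, (j < m)%N ->
    g %| ('X + (t + e j)%:P) * (al j * h j ^+ l) - 1.
Proof.
move=> l0 co.
have [|t [h hP]] := @pac_cover_point k g D m l e al (fun=> 0) 0 g_monic g_sep
  size_g (prime_gt1 l_pr) co _ k_pac.
  move=> L i th gE; rewrite !rmorph0; apply: kummer_cover => //.
  - by rewrite -(rmorph_nat i) fmorph_eq0.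
  - exact: shift_inj.
  - move=> x; have := co (x %/ D.+1)%N; rewrite -(coprimep_map i).
    move/coprimep_root; apply; apply/rootP.
    have lts : (x %% D.+1 < D.+1)%N by rewrite ltn_mod.
    by rewrite gE horner_prod (bigD1 (Ordinal lts)) //= !hornerE subrr mul0r.
  - by move=> x; rewrite horner0.
exists t, h => j ltjm; have := hP j ltjm.
by rewrite /cover_eq polyC0 mul0r !subr0.
Qed.

Lemma pac_artin_schreier (be : nat -> {poly k}) : l \in [pchar k] ->
  exists t (h : nat -> {poly k}), forall j, (j < m)%N ->
    g %| ('X + (t + e j)%:P) * (h j ^+ l - h j - be j) - 1.
Proof.
move=> lk.
have [||t [h hP]] := @pac_cover_point k g D m l e (fun=> 1) be 1 g_monic g_sep
  size_g (prime_gt1 l_pr) _ _ k_pac.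
- by move=> j; rewrite coprimep1.
- move=> L i th gE; rewrite !rmorph1; apply: artin_schreier_cover => //.
  + by rewrite (rmorph_pchar i).
  + exact: shift_inj.
  + by move=> x; rewrite hornerC.
exists t, h => j ltjm; have := hP j ltjm.
by rewrite /cover_eq polyC1 !mul1r.
Qed.

End PacCovers.

Lemma pac_infinite (k : fieldType) : pseudo_algebraically_closed k ->
  forall s : seq k, exists x, x \notin s.
Proof.
move=> pac s0; apply: NNPP => nex.
have all_s0 x : x \in s0 by apply/idPn => xs; apply: nex; exists x.
pose s := undup s0; have all_s x : x \in s by rewrite mem_undup.
(* A solution for [g = 'X] and shifts [e_j] exhausting [k] would give [t] with
   [t + e_j != 0] for all [j]. *)
have [l l_pr l0] : exists2 l, prime l & (l%:R != 0 :> k).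
  have [two0|two0] := eqVneq (2%:R : k) 0; last by exists 2.
  by exists 3 => //; rewrite mulrS two0 addr0 oner_eq0.
have X_sep : @separable_poly k 'X.
  by have := separable_prod_XsubC [:: 0 : k]; rewrite big_seq1 subr0 => ->.
have X_gt1 : (1 < size ('X : {poly k}))%N by rewrite size_polyX.
have shift i j : (i < size s)%N -> (j < size s)%N -> i != j ->
    coprimep 'X ('X \Po ('X + (s`_i - s`_j)%:P)).
  move=> lti ltj ij; rewrite comp_polyX coprimep_sym coprimepX rootE !hornerE.
  by rewrite subr_eq0 nth_uniq // undup_uniq.
have [t [h hP]] := pac_kummer pac (monicX k) X_sep X_gt1 l_pr shift l0
  (fun=> coprimep1 'X).
have := hP (index (- t) s); rewrite index_mem nth_index // => /(_ (all_s _)).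
case/dvdpP=> q /(congr1 (horner^~ 0)); rewrite subrr addr0 !hornerE.
by move=> /eqP; rewrite oppr_eq0 oner_eq0.
Qed.

Lemma infinite_uniq_seq (T : eqType) : (forall s : seq T, exists x, x \notin s)
  ->
  forall n, exists2 s : seq T, uniq s & size s = n.
Proof.
move=> inf; elim=> [|n [s us <-]]; first by exists [::].
by have [x xs] := inf s; exists (x :: s); rewrite //= xs.
Qed.

Lemma coprimep_prod_XsubC (E : fieldType) (rs : seq E) (q : {poly E}) :
  (forall r, r \in rs -> ~~ root q r) -> coprimep (\prod_(r <- rs) ('X - r%:P))
    q.
Proof.
elim: rs => [|r rs IHrs] nroot; first by rewrite big_nil coprime1p.
rewrite big_cons coprimepMl IHrs ?andbT => [|r' r'rs]; last first.
  by apply: nroot; rewrite inE r'rs orbT.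
by rewrite coprimep_sym coprimep_XsubC nroot ?mem_head.
Qed.

(** It suffices that [eta] avoid the roots of all ['X^c - 'X^d - b], where [b] runs over the
    differences of roots of [g] in a splitting field. These are finitely many nonzero polynomials,
    and [k] is infinite. *)
Lemma generic_shifts (k : fieldType) (g : {poly k}) (M : nat) :
    (forall s : seq k, exists x, x \notin s) -> g != 0 ->
  exists eta : k, forall c d, (c < M)%N -> (d < M)%N -> c != d ->
    coprimep g (g \Po ('X + (eta ^+ c - eta ^+ d)%:P)).
Proof.
move=> inf g0; have [E [rs gE]] := split_extension g0.
pose bad := [seq r' - r | r <- rs, r' <- rs].
pose Q (c d : nat) (b : E) : {poly E} := 'X^c - 'X^d - b%:P.
pose Psi := \prod_(c < M) \prod_(d < M | c != d :> nat) \prod_(b <- bad) Q c d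
  b.
have Q0 c d b : c != d -> Q c d b != 0.
  move=> cd; apply/eqP => Qcd.
  have := congr1 (fun p : {poly E} => p`_c) Qcd.
  have := congr1 (fun p : {poly E} => p`_d) Qcd.
  rewrite !coefB !coefXn !coefC !eqxx ?coef0 [d == c]eq_sym (negPf cd).
  (* For [c = 0] the coefficient at [c] also involves [b], so the coefficient at [d] is used
     instead. *)
  case: c cd {Qcd} => [|c] cd; last by rewrite /= subr0 subr0 => _ /eqP;
    rewrite oner_eq0.
  case: d cd => [|d] // _ /eqP.
  by rewrite /= sub0r subr0 oppr_eq0 oner_eq0.
have Psi0 : Psi != 0.
  rewrite prodf_seq_neq0; apply/allP => c _ /=.
  rewrite prodf_seq_neq0; apply/allP => d _; apply/implyP => cd.
  by rewrite prodf_seq_neq0; apply/allP => b _; apply: Q0.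
have [s us szs] := infinite_uniq_seq inf (size Psi).
have [eta Psieta] : exists eta, ~~ root Psi (in_alg E eta).
  apply: NNPP => nex.
  have := @max_poly_roots _ Psi (map (in_alg E) s) Psi0.
  rewrite map_inj_uniq ?size_map ?szs ?ltnn //; last exact: fmorph_inj.
  move=> H; suff: false by []; apply: H => //.
  apply/allP => _ /mapP[x _ ->]; apply/idPn => nr; apply: nex; by exists x.
exists eta => c d ltc ltd cd; set de := _ - _.
rewrite -(coprimep_map (in_alg E)) (eqp_coprimepl _ gE).
apply: coprimep_prod_XsubC => r rrs; apply: contra Psieta.
rewrite map_comp_poly rootE horner_comp rmorphD /= map_polyX map_polyC !hornerE.
rewrite -rootE (eqp_root gE) root_prod_XsubC => r'rs.
rewrite rootE horner_prod (bigD1 (Ordinal ltc)) //= horner_prod.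
rewrite (bigD1 (Ordinal ltd)) //= horner_prod.
rewrite (big_rem (de%:A)) /=; last first.
  by apply/allpairsP; exists (r, r + de%:A); split=> //=; rewrite addrC addKr.
rewrite /Q !hornerE -!in_algE -!rmorphXn -!rmorphB subrr.
by rewrite rmorph0 !mul0r.
Qed.

(** * Descent of solutions to a relatively algebraically closed subfield *)

Section RelativelyClosed.

Variables (k K : fieldType) (iota : {rmorphism k -> K}).
Hypothesis rac : forall x, algebraicOver iota x -> exists y, x = iota y.

(** Newton interpolation, one node at a time: divided differences of algebraic values at algebraic
    nodes are algebraic. *)
Lemma interpolation_integral (E : fieldType) (j : {rmorphism k -> E})
    (rs : seq E) (p : {poly E}) :
    uniq rs -> (size p <= size rs)%N ->
    (forall r, r \in rs -> integralOver j r /\ integralOver j p.[r]) ->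
  forall i, integralOver j p`_i.
Proof.
elim: rs p => [|r rs IHrs] p /=.
  move=> _; rewrite leqn0 size_poly_eq0 => /eqP -> _ i.
  by rewrite coef0; apply: integral0.
case/andP=> rrs urs szp intp.
have [intr intpr] := intp r (mem_head _ _).
have [q qE] : exists q, p - p.[r]%:P = q * ('X - r%:P).
  by apply/factor_theorem; rewrite rootE !hornerE subrr.
have pE : p = q * ('X - r%:P) + p.[r]%:P by rewrite -qE subrK.
have szq : (size q <= size rs)%N.
  have [->|q0] := eqVneq q 0; first by rewrite size_poly0.
  have : size (p - p.[r]%:P) = (size q).+1 by rewrite qE size_mul
    ?polyXsubC_eq0 // size_XsubC addn2.
  move=> szE; rewrite -ltnS -szE (leq_trans (size_polyD _ _)) // size_polyN.
  rewrite geq_max (leq_trans szp) //=.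
  by rewrite (leq_trans (size_polyC_leq1 _)).
have intq : forall i, integralOver j q`_i.
  apply: IHrs => // r' r'rs.
  have [intr' intpr'] := intp r' (mem_behead (r'rs : r' \in behead (r :: rs))).
  split=> //; have r'r : r' - r != 0.
    by rewrite subr_eq0; apply: contraNneq rrs => <-.
  have -> : q.[r'] = (p.[r'] - p.[r]) / (r' - r).
    by rewrite {1}pE !hornerE addrK mulfK.
  by apply: integral_div; apply: integral_sub.
move=> i; rewrite pE coefD coefC mulrBr coefB coefMX coefMC.
apply: integral_add; last by case: ifP => // _; apply: integral0.
apply: integral_sub; last exact: integral_mul.
by case: ifP => // _; apply: integral0.
Qed.

(** Let [r] be [h] reduced modulo [g]. At a root [th] of [g], its value is a root of the monic
    polynomial ['X^l - 'X *+ eps - a(th)], hence algebraic over [k]. By interpolation the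
    coefficients of [r] are algebraic over [k]; as elements of [K] they come from [k]. *)
Lemma rac_descent (g a : {poly k}) (l : nat) (eps : bool) (h : {poly K}) :
    g \is monic -> separable_poly g -> (1 < l)%N ->
    map_poly iota g %| h ^+ l - h *+ eps - map_poly iota a ->
  exists h0 : {poly k}, g %| h0 ^+ l - h0 *+ eps - a.
Proof.
move=> g_monic g_sep l_gt1 dvh; set gK := map_poly iota g in dvh.
have gK0 : gK != 0 by rewrite map_poly_eq0 monic_neq0.
pose r := h %% gK.
have dvr : gK %| r ^+ l - r *+ eps - map_poly iota a.
  have dvhr : gK %| h - r by rewrite /r {1}(divp_eq h gK) addrK dvdp_mull.
  have -> : r ^+ l - r *+ eps - map_poly iota a
      = (h ^+ l - h *+ eps - map_poly iota a) - ((h ^+ l - r ^+ l) - (h - r) *+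
        eps).
    by rewrite mulrnBl; ring.
  apply: dvdp_sub => //; apply: dvdp_sub; last by rewrite -mulr_natr dvdp_mulr.
  by rewrite subrXX dvdp_mulr.
have [E [rs gE]] := split_extension gK0.
pose j : {rmorphism k -> E} := in_alg E \o iota.
have gjE : map_poly j g = map_poly (in_alg E) gK.
  by rewrite -map_poly_comp.
have urs : uniq rs.
  by rewrite -separable_prod_XsubC -(eqp_separable gE) separable_map
    separable_map.
have szrs : size rs = (size g).-1.
  by rewrite -(size_map_poly j) gjE (eqp_size gE) size_prod_XsubC.
have int_r i : integralOver j (map_poly (in_alg E) r)`_i.
  apply: (@interpolation_integral E j rs) => //.
    rewrite size_map_poly szrs -ltnS prednK ?size_poly_gt0 ?monic_neq0 //.
    by rewrite -(size_map_poly iota) ltn_modp.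
  move=> th thrs.
  have root_th : root (map_poly j g) th by rewrite gjE (eqp_root gE)
    root_prod_XsubC.
  have int_th : integralOver j th by exists g.
  split=> //.
  have int_jth (p : {poly k}) : integralOver j (map_poly j p).[th].
    apply: integral_horner int_th; apply/integral_poly => i'.
    by rewrite coef_map; apply: integral_id.
  have p_mon : 'X^l - ('X *+ eps + (map_poly j a).[th]%:P) \is monic.
    rewrite monicE lead_coefDl ?lead_coefXn // size_polyXn size_polyN.
    rewrite (leq_ltn_trans (size_polyD _ _)) // gtn_max !ltnS.
    rewrite (leq_trans (size_polyC_leq1 _)) ?(ltnW l_gt1) // andbT.
    by case: (eps); rewrite ?size_polyX ?size_poly0.
  apply: (integral_root_monic p_mon).
    have /dvdpP[q qE] := dvr.
    have := congr1 (fun p => (map_poly (in_alg E) p).[th]) qE.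
    rewrite !rmorphB !rmorphM rmorphXn rmorphMn /= -map_poly_comp -gjE.
    rewrite !hornerM (rootP root_th) mulr0 !hornerD !hornerN horner_exp
      hornerMn.
    rewrite rootE !hornerD !hornerN !hornerD hornerXn hornerMn hornerX hornerC.
    by move=> /eqP; rewrite opprD addrA.
  apply/integral_poly => i'; rewrite coefB coefXn coefD coefMn coefX coefC.
  apply: integral_sub; first exact: integral_nat.
  apply: integral_add.
    by rewrite -mulrnA; apply: integral_nat.
  by case: ifP => _; [apply: int_jth|apply: integral0].
have ex_c i : exists y, r`_i = iota y.
  apply: rac; have /integral_algebraic[p p0] := int_r i.
  rewrite coef_map /= => rp; exists p => //.
  by move: rp; rewrite /j map_poly_comp /= -in_algE fmorph_root.
pose cf i := sval (constructive_indefinite_description _ (ex_c i)).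
have cfE i : r`_i = iota (cf i) by rewrite /cf; case:
  constructive_indefinite_description.
exists (\poly_(i < size r) cf i).
rewrite -(dvdp_map iota) !rmorphB rmorphXn rmorphMn /=.
suff -> : map_poly iota (\poly_(i < size r) cf i) = r by [].
apply/polyP => i; rewrite coef_map coef_poly; case: ltnP => [_|le]; first by
  rewrite cfE.
by rewrite raddf0 nth_default.
Qed.

End RelativelyClosed.

(** * Patterns *)

Section CoverPattern.

Variables (k K : fieldType) (iota : {rmorphism k -> K}).
Hypothesis k_pac : pseudo_algebraically_closed k.
Hypothesis rac : forall x, algebraicOver iota x -> exists y, x = iota y.

Variables (g a : {poly k}) (l : nat) (eps : bool).
Hypotheses (g_monic : g \is monic) (g_irr : irreducible_poly g).
Hypotheses (g_sep : separable_poly g) (l_pr : prime l).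
Hypothesis l_char : if eps then l \in [pchar k] else l%:R != 0 :> k.
Hypothesis no_root : forall h : {poly k}, ~ g %| h ^+ l - h *+ eps - a.

Let gK := map_poly iota g.

(** The bound on [h] can always be reached by reduction modulo [g]; it fixes the number of
    coefficients to be quantified in the formula. *)
Definition cover_solvable (c : K) : Prop := exists h : {poly K},
  (size h < size gK)%N /\ gK %| ('X + c%:P) * (h ^+ l - h *+ eps) - 1.

Lemma cover_solvable_small (c : K) (h : {poly K}) :
  gK %| ('X + c%:P) * (h ^+ l - h *+ eps) - 1 -> cover_solvable c.
Proof.
have gK0 : gK != 0 by rewrite map_poly_eq0 monic_neq0.
move=> dvh; exists (h %% gK); rewrite ltn_modp; split=> //.
have -> : ('X + c%:P) * ((h %% gK) ^+ l - (h %% gK) *+ eps) - 1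
    = ('X + c%:P) * (h ^+ l - h *+ eps) - 1
      - ('X + c%:P) * ((h ^+ l - (h %% gK) ^+ l) - (h - h %% gK) *+ eps).
  by rewrite mulrnBl; ring.
have dvhr : gK %| h - h %% gK by rewrite {1}(divp_eq h gK) addrK dvdp_mull.
apply: dvdp_sub => //; apply/dvdp_mull/dvdp_sub.
  by rewrite subrXX dvdp_mulr.
by rewrite -mulr_natr dvdp_mulr.
Qed.

Let no_rootK (h : {poly K}) : ~ gK %| h ^+ l - h *+ eps - map_poly iota a.
Proof.
by move=> /(rac_descent rac g_monic g_sep (prime_gt1 l_pr))[h0 /no_root].
Qed.

Lemma cover_pattern (m : nat) (e : nat -> k) (J : nat -> bool) :
    (forall i j, (i < m)%N -> (j < m)%N -> i != j ->
      coprimep g (g \Po ('X + (e i - e j)%:P))) ->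
  exists t, forall j, (j < m)%N -> cover_solvable (iota (t + e j)) <-> J j.
Proof.
move=> shift; have g_gt1 : (1 < size g)%N by case: g_irr.
have l_gt0 := prime_gt0 l_pr.
have nroot := no_root; have nrootK := no_rootK; have lk := l_char.
have small := cover_solvable_small; rewrite /cover_solvable in small *.
have [eps1|eps0] : eps = true \/ eps = false by case: (eps); [left|right].
- rewrite eps1 /= in nroot nrootK lk small *.
  have [t [h hP]] := pac_artin_schreier k_pac g_monic g_sep g_gt1 l_pr shift
    (fun j => if J j then 0 else a) lk.
  exists t => j ltjm; have := hP j ltjm; rewrite -(dvdp_map iota).
  rewrite rmorphB rmorphM rmorphD !rmorphB rmorphXn rmorph1 /=.
  rewrite map_polyX map_polyC /= -/gK.
  case: ifP => _; first by rewrite rmorph0 subr0 => /small.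
  set c := 'X + _; set h1 := map_poly iota (h j) => dv1.
  split=> // -[h2 [_ dv2]].
  (* Subtracting the two equations and cancelling [c], a unit modulo [g], leaves [h1 - h2] as a
     forbidden preimage of [a]. *)
  case: (nrootK (h1 - h2)); rewrite mulr1n.
  have coc : coprimep gK c.
    have /dvdpP[q qE] := dv1.
    apply/Bezout_eq1_coprimepP; exists (- q, h1 ^+ l - h1 - map_poly iota a) =>
      /=.
    by rewrite mulNr -qE [_ * c]mulrC; ring.
  rewrite -(Gauss_dvdpr _ coc).
  have lK : [pchar {poly K}].-nat l.
    by rewrite pnatE // (rmorph_pchar (@polyC K)) ?(rmorph_pchar iota).
  rewrite exprDn_pchar // exprNn_pchar //.
  have -> : c * (h1 ^+ l - h2 ^+ l - (h1 - h2) - map_poly iota a)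
     = (c * (h1 ^+ l - h1 - map_poly iota a) - 1) - (c * (h2 ^+ l - h2) - 1) by
       ring.
  exact: dvdp_sub.
- rewrite eps0 /= in nroot nrootK lk small *.
  have a_co : coprimep g a.
    rewrite irreducible_poly_coprime //; apply/negP => ga.
    by apply: (nroot 0); rewrite expr0n gtn_eqF // mulr0n subr0 sub0r dvdpNr.
  have al_co j : coprimep g (if J j then 1 else a).
    by case: ifP => _; rewrite ?coprimep1.
  have [t [h hP]] := pac_kummer k_pac g_monic g_sep g_gt1 l_pr shift lk al_co.
  exists t => j ltjm; have := hP j ltjm; rewrite -(dvdp_map iota).
  rewrite rmorphB !rmorphM rmorphD rmorphXn rmorph1 /=.
  rewrite map_polyX map_polyC /= -/gK.
  case: ifP => _.
    by rewrite rmorph1 mul1r -[_ ^+ l]subr0 => /small.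
  set c := 'X + _; set h1 := map_poly iota (h j); set aK := map_poly iota a =>
    dv1.
  split=> // -[h2 [_]]; rewrite mulr0n subr0 => dv2.
  (* Modulo [g], [c * aK * h1 ^+ l = 1] and [c * h2 ^+ l = 1], so [h2 / h1] is an [l]-th root of
     [aK]; the inverse of [h1] is [c * aK * h1 ^+ l.-1]. *)
  case: (nrootK (h2 * c * aK * h1 ^+ l.-1)); rewrite mulr0n subr0 -/aK.
  set u := c * (aK * h1 ^+ l) in dv1; set v := c * h2 ^+ l in dv2.
  have -> : (h2 * c * aK * h1 ^+ l.-1) ^+ l = aK * (v * u ^+ l.-1).
    rewrite /u /v !exprMn -[_ ^+ l.-1 ^+ l]exprM -[_ ^+ l ^+ l.-1]exprM.
    rewrite [(l.-1 * l)%N]mulnC.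
    have -> : c ^+ l = c * c ^+ l.-1 by rewrite -exprS prednK.
    have -> : aK ^+ l = aK * aK ^+ l.-1 by rewrite -exprS prednK.
    by ring.
  have -> : aK * (v * u ^+ l.-1) - aK
      = aK * ((v - 1) * u ^+ l.-1 + (u ^+ l.-1 - 1)) by ring.
  apply: dvdp_mull; apply: dvdp_add; first exact: dvdp_mulr.
  by rewrite subrX1 dvdp_mulr.
Qed.

End CoverPattern.

(** * Cyclic obstructions in a field that is not separably closed *)

(** The subfield generated by the roots in an extension that splits [p], taken as an extension in
    its own right. *)
Lemma splitting_field_exists (F : fieldType) (p : {poly F}) : p != 0 ->
  exists E : splittingFieldType F,
    splittingFieldFor 1 (map_poly (in_alg E) p) {:E}.
Proof.
move=> p0.
suff [E splitE] : exists E : fieldExtType F,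
    splittingFieldFor 1 (map_poly (in_alg E) p) {:E}.
  have ax : SplittingField.axiom E.
    by exists (map_poly (in_alg E) p) => //; apply/polyOver1P; exists p.
  pose M := FieldExt_isSplittingField.Build F E ax.
  by exists (HB.pack_for (splittingFieldType F) E M).
have [L [ys Dp]] := split_extension p0.
pose Lp := subvs_of <<1 & ys>>; pose toL := linfun (vsval : Lp -> L).
have [zs Dys] : {zs | map toL zs = ys}.
  exists (map (vsproj _) ys); rewrite -map_comp map_id_in // => y ys_y.
  by rewrite /= lfunE /= vsprojK ?seqv_sub_adjoin.
exists Lp, zs.
  set lhs := (lhs in lhs %= _); set rhs := (rhs in _ %= rhs).
  suffices: map_poly toL lhs %= map_poly toL rhs by rewrite eqp_map.
  rewrite -Dys big_map in Dp; apply: etrans Dp; apply: congr2.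
    by rewrite -map_poly_comp; apply/eq_map_poly=> x; apply: rmorph_alg.
  rewrite rmorph_prod; apply/eq_bigr=> z _.
  by rewrite rmorphB /= map_polyX map_polyC.
set Lzs := LHS; pose Lys := (toL @: Lzs)%VS; apply/vspaceP=> u.
have: val u \in Lys by rewrite /Lys aimg_adjoin_seq aimg1 Dys (valP u).
by case/memv_imgP=> v Lzs_v; rewrite memvf lfunE => /val_inj->.
Qed.

Section CyclicGalois.

Import FalgLfun.

Variables (F : fieldType) (E : splittingFieldType F) (l : nat).
Hypothesis l_pr : prime l.
Variable x : gal_of {:E}.
Hypothesis ord_x : #[x]%g = l.

Let k' := fixedField <[x]>%g.

Let x_fixed y : (y \in k') = (x y == y).
Proof.
apply/idP/eqP => [/mem_fixedFieldP[_]|xy]; first by apply; apply: cycle_id.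
apply/fixedFieldP; first exact: memvf.
move=> _ /cycleP[n ->]; elim: n => [|n IHn]; first exact: gal_id.
by rewrite expgS galM ?memvf // xy.
Qed.

Let x_moves : exists y, x y != y.
Proof.
apply: NNPP => nex; have : #[x]%g != 1%N by rewrite ord_x; case: l l_pr =>
  [|[]].
rewrite order_eq1; case/negP; apply/gal_eqP => y _; rewrite gal_id.
by apply/eqP/idPn => nxy; apply: nex; exists y.
Qed.

(** The norm of [z] for the group generated by [x] is [z ^+ l = 1], so Hilbert's theorem 90 gives
    [b] with [z = b / x b]. Then [b ^+ l] is fixed and [b] is not. A fixed [l]-th root of [b ^+ l]
    would differ from [b] by a power of [z], which is fixed too. *)
Lemma kummer_generator (z : E) : l.-primitive_root z -> z \in k' ->
  exists2 b, b ^+ l \in k' & forall c, c \in k' -> c ^+ l != b ^+ l.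
Proof.
move=> z_prim zk; have l_gt0 := prime_gt0 l_pr.
have gen : generator 'Gal({:E} / k') x by rewrite gal_fixedField
  generator_cycle.
have normz : galNorm k' {:E} z == 1.
  rewrite /galNorm gal_fixedField (eq_bigr (fun=> z)).
    by rewrite prodr_const -orderE ord_x (prim_expr_order z_prim).
  by move=> y yx; have [_ ->] := mem_fixedFieldP zk.
have [b [_ b0] bE] := Hilbert's_theorem_90 gen (memvf z) normz.
have z0 : z != 0 by rewrite (prim_root_eq0 z_prim) gtn_eqF.
have xb0 : x b != 0 by rewrite fmorph_eq0.
have xbE : b = z * x b by rewrite bE divfK.
exists b.
  rewrite x_fixed rmorphXn /= {2}xbE exprMn (prim_expr_order z_prim) mul1r //.
move=> c ck; apply/eqP => cb.
have c0 : c != 0.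
  apply: contra_neq (expf_neq0 l b0) => c0.
  by rewrite -cb c0 expr0n gtn_eqF.
have [[i lti] /= bc] : {i : 'I_l | b / c = z ^+ i}.
  by apply: (prim_rootP z_prim); rewrite exprMn exprVn cb divff ?expf_neq0.
have : b \in k' by rewrite -(divfK c0 b) bc rpredM ?rpredX.
rewrite x_fixed => /eqP xb; have : z == 1 by rewrite bE xb divff.
move=> /eqP z1; move: (prim_order_dvd z_prim 1).
by rewrite z1 expr1n eqxx dvdn1 => /eqP l1; move: l_pr; rewrite l1.
Qed.

Lemma artin_schreier_generator : l \in [pchar E] ->
  exists2 b, b ^+ l - b \in k' & forall c, c \in k' -> c ^+ l - c != b ^+ l - b.
Proof.
move=> lE; pose s : 'End(E) := x.
have sX n y : (s ^+ n) y = (x ^+ n)%g y.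
  elim: n y => [|n IHn] y; first by rewrite expr0 gal_id [LHS]id_lfunE.
  by rewrite expgS galM ?memvf // -IHn exprS lfun_mulE.
have lF : l%:R = 0 :> F.
  by apply: (fmorph_inj (in_alg E)); rewrite rmorph0 rmorph_nat (pcharf0 lE).
have lEnd : l \in [pchar 'End(E)].
  by rewrite inE l_pr /= -(rmorph_nat (in_alg 'End(E))) lF rmorph0.
(* Let [(s - 1) ^ (r + 1)] be the last nonzero power, [w] a nonzero value of it
   at [y] and [v = (s - 1) ^ r y]: then [x v = v + w] and [x w = w], so [v / w]
   is mapped to [v / w + 1]. *)
have d_nil : (s - 1) ^+ l = 0.
  (* In characteristic [l], [(s - 1) ^+ l = s ^+ l - 1], and [s] has order [l]. *)
  rewrite -(pFrobenius_autE lEnd) pFrobenius_autB_comm; last exact: commr1.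
  rewrite !pFrobenius_autE expr1n; apply/eqP; rewrite subr_eq0; apply/eqP.
  apply/lfunP => y; rewrite sX -ord_x expg_order gal_id.
  by rewrite id_lfunE.
have ex_nil : exists n, (s - 1) ^+ n == 0 by exists l; apply/eqP.
case: (ex_minnP ex_nil) => r /eqP r_nil r_min.
case: r r_nil r_min => [|[|r]] r_nil r_min.
- by move/eqP: r_nil; rewrite expr0 oner_eq0.
- have [y] := x_moves; case/eqP; apply/eqP; rewrite -subr_eq0.
  move: r_nil; rewrite expr1 => /lfunP/(_ y).
  by rewrite add_lfunE opp_lfunE id_lfunE zero_lfunE => /eqP.
have [y dy] : exists y, ((s - 1) ^+ r.+1) y != 0.
  apply: NNPP => nex; suff : (r.+1 < r.+1)%N by rewrite ltnn.
  apply: r_min; apply/eqP/lfunP => y; rewrite zero_lfunE.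
  by apply/eqP/idPn => ny; apply: nex; exists y.
pose w := ((s - 1) ^+ r.+1) y; pose v := ((s - 1) ^+ r) y.
have dE t : (s - 1) t = x t - t by rewrite add_lfunE opp_lfunE id_lfunE.
have dv : x v - v = w by rewrite -dE /v /w exprSr lfun_mulE.
have xw : x w = w.
  apply/eqP; rewrite -subr_eq0 -dE; apply/eqP.
  transitivity (((s - 1) ^+ r.+2) y); last by rewrite r_nil zero_lfunE.
  by rewrite /w [in RHS]exprSr lfun_mulE.
pose b := v / w.
have xb : x b = b + 1.
  by rewrite /b rmorphM fmorphV /= xw -(subrK v (x v)) dv mulrDl divff // addrC.
have lP : [pchar E].-nat l by rewrite pnatE.
exists b.
  by rewrite x_fixed rmorphB rmorphXn /= xb exprDn_pchar // expr1n; apply/eqP;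
    ring.
move=> c ck; apply/eqP => cb.
have [i bci] : exists i, b - c = i%:R.
  apply: (frobenius_fixed l_pr lE); rewrite exprDn_pchar // exprNn_pchar //.
  have -> : b ^+ l = c ^+ l - c + b by rewrite cb subrK.
  by ring.
have : b \in k' by rewrite -(subrK c b) bci rpredD ?rpred_nat.
rewrite x_fixed xb => /eqP /(canRL (addKr _)); rewrite addNr => /eqP.
by rewrite oner_eq0.
Qed.

End CyclicGalois.

(* The obstruction [a] lives in the simple extension [k[X]/g]: it is not an
   [l]-th power there (when [eps] is false), respectively not of the form
   [h ^+ l - h] (when [eps] is true). *)
Definition cyclic_obstruction (k : fieldType) (g a : {poly k}) (l : nat)
    (eps : bool) : Prop :=
  [/\ g \is monic, irreducible_poly g, separable_poly g, prime l
    & (if eps then l \in [pchar k] else l%:R != 0 :> k) /\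
      forall h : {poly k}, ~ g %| h ^+ l - h *+ eps - a].

Lemma irreducible_minPoly (k : fieldType) (L : fieldExtType k) (x : L)
    (f : {poly k}) :
  minPoly 1 x = map_poly (in_alg L) f -> irreducible_poly f.
Proof.
move=> fE; have szf : size f = (adjoin_degree 1 x).+1.
  by rewrite -(size_map_poly (in_alg L)) -fE size_minPoly.
split=> [|q q1 qf]; first by rewrite szf.
have dv : map_poly (in_alg L) q %| minPoly 1 x by rewrite fE dvdp_map.
have /orP[] := minPoly_irr (alg_polyOver _ q) dv.
  by rewrite fE eqp_map.
by rewrite -size_poly_eq1 size_map_poly (negPf q1).
Qed.

(** By the primitive element theorem [k' = k(th)]. Take for [g] the minimal polynomial of [th] and
    for [a] a polynomial with value [b] at [th]. *)
Lemma obstruction_in_subfield (k : fieldType) (E : fieldExtType k)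
    (k' : {subfield E}) (b : E) (l : nat) (eps : bool) :
    separable 1 k' -> prime l ->
    (if eps then l \in [pchar k] else l%:R != 0 :> k) ->
    b \in k' -> (forall c, c \in k' -> c ^+ l - c *+ eps != b) ->
  exists g a, @cyclic_obstruction k g a l eps.
Proof.
move=> sep l_pr l_char bk nob.
have [th thsep kE] : exists2 th, separable_element 1 th & (k' : {vspace E}) =
  <<1; th>>%VS.
  exists (separable_generator 1 k'); first exact: separable_generatorP.
  exact: (eq_adjoin_separable_generator sep (sub1v _)).
have /polyOver1P[g gE] := minPolyOver 1 th.
have /Fadjoin1_polyP[a aE] : b \in <<1; th>>%VS by rewrite -kE.
exists g, a; split=> //.
- by rewrite -(map_monic (in_alg E)) -gE monic_minPoly.
- exact: irreducible_minPoly gE.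
- by move: thsep; rewrite /separable_element gE separable_map.
split=> // h gh.
have := nob (map_poly (in_alg E) h).[th].
rewrite kE; case/(_ _)/eqP.
  by apply/Fadjoin1_polyP; exists h.
have : root (map_poly (in_alg E) (h ^+ l - h *+ eps - a)) th.
  have /dvdpP[q ->] := gh.
  by rewrite rmorphM /= -gE rootM root_minPoly orbT.
rewrite !rmorphB rmorphXn rmorphMn /= rootE !hornerD !hornerN horner_exp
  hornerMn.
by rewrite -aE subr_eq0 => /eqP.
Qed.

(** Let [l] be a prime dividing the degree of a separable element outside [k]. In a Galois extension
    containing its conjugates and, if [l] is not the characteristic, the [l]-th roots of unity,
    Cauchy's theorem yields an automorphism of order [l] that fixes these roots of unity. Its fixed
    field is [k']. *)
Lemma cyclic_obstruction_exists (k : fieldType) : ~ separably_closed k ->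
  exists g a l eps, @cyclic_obstruction k g a l eps.
Proof.
move=> nsc.
have [L [sepL [al al1]]] : exists L : fieldExtType k,
    separable 1 {:L} /\ exists al : L, al \notin 1%VS.
  apply: NNPP => nex; apply: nsc => L sepL.
  apply/eqP; rewrite eqEsubv sub1v andbT; apply/subvP => al _.
  by apply/idPn => nal; apply: nex; exists L; split=> //; exists al.
have /polyOver1P[f fE] := minPolyOver 1 al.
have f_irr := irreducible_minPoly fE.
have f_sep : separable_poly f.
  have /separableP/(_ al (memvf _)) := sepL.
  by rewrite /separable_element fE separable_map.
have f0 := irredp_neq0 f_irr.
pose d := adjoin_degree 1 al.
have d_gt1 : (1 < d)%N.
  have : (0 < d)%N by [].
  by rewrite leq_eqVlt eq_sym adjoin_deg_eq1 (negPf al1).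
have szf : size f = d.+1.
  by rewrite -(size_map_poly (in_alg L)) -fE size_minPoly.
pose l := pdiv d; have l_pr : prime l := pdiv_prime d_gt1.
have l_gt0 := prime_gt0 l_pr.
have ld : (l %| d)%N := pdiv_dvd d.
pose eps := l \in [pchar k].
have l_char : if eps then l \in [pchar k] else l%:R != 0 :> k.
  by case: ifP; rewrite /eps // => /negbT; rewrite inE l_pr.
(* The splitting field has to contain the [l]-th roots of unity; they generate
   an extension of degree less than [l], so [l] still divides what remains. *)
pose cyc : {poly k} := if eps then 1 else 'X^l - 1.
(* If [f] already divides [cyc], the product would have a repeated factor and not be separable. *)
pose q := if f %| cyc then cyc else f * cyc.
have fq : f %| q by rewrite /q; case: ifP => // _; apply: dvdp_mulr.
have cycq : cyc %| q by rewrite /q; case: ifP => // _; apply: dvdp_mull.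
have cyc_sep : separable_poly cyc.
  move: l_char; rewrite /cyc; case: (eps) => [_|l0].
    by rewrite separable_poly.unlock coprime1p.
  exact: separable_XnsubC1 (prime_gt1 l_pr) l0.
have q_sep : separable_poly q.
  rewrite /q; case: ifP => // nfc.
  by rewrite separable_mul f_sep cyc_sep irreducible_poly_coprime ?nfc.
have [E splitE] := splitting_field_exists (separable_poly_neq0 q_sep).
have galE : galois 1 {:E}.
  apply/splitting_galoisField; exists (map_poly (in_alg E) q); split=> //.
  - exact: alg_polyOver.
  - by rewrite separable_map.
have [rs qE _] := splitE.
have l_dimE : (l %| \dim {:E})%N.
  have [r fr] : exists r, root (map_poly (in_alg E) f) r.
    have dvf : map_poly (in_alg E) f %| \prod_(r <- rs) ('X - r%:P).
      by rewrite -(eqp_dvdr _ qE) dvdp_map.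
    have [m fm] := dvdp_prod_XsubC dvf.
    have : (1 < size f)%N by case: f_irr.
    rewrite -(size_map_poly (in_alg E)) (eqp_size fm).
    case: (mask m rs) fm => [|r s] fm; first by rewrite big_nil size_poly1.
    by exists r; rewrite (eqp_root fm) root_prod_XsubC mem_head.
  have szm : size (minPoly 1 r) = size f.
    have dv : minPoly 1 r %| map_poly (in_alg E) f.
      exact: minPoly_dvdp (alg_polyOver _ f) fr.
    have /polyOver1P[p pE] : minPoly 1 r \is a polyOver 1%VS := minPolyOver 1 r.
    rewrite pE dvdp_map in dv; rewrite pE size_map_poly.
    apply: eqp_size; apply: f_irr dv.
    by rewrite -(size_map_poly (in_alg E)) -pE size_minPoly.
  have degr : adjoin_degree 1 r = d.
    by apply: succn_inj; rewrite -size_minPoly szm.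
  have dimr : \dim <<1; r>> = d by rewrite dim_Fadjoin degr dimv1 muln1.
  by apply: (dvdn_trans ld); rewrite -dimr; apply: field_dimS; apply: subvf.
have [k1 l_dim k1z] : exists2 k1 : {subfield E}, ~~ (l %| \dim k1)%N
    & ~~ eps -> exists2 z, z \in k1 & l.-primitive_root z.
  case: (boolP eps) => [_|neps].
    by exists 1%AS => //; rewrite dimv1 dvdn1 gtn_eqF ?prime_gt1.
  have l0E : l%:R != 0 :> E.
    rewrite -(rmorph_nat (in_alg E)) fmorph_eq0.
    by move: l_char; rewrite (negPf neps).
  have cycE : cyc = 'X^l - 1 by rewrite /cyc (negPf neps).
  have dvc : map_poly (in_alg E) cyc %| \prod_(r <- rs) ('X - r%:P).
    by rewrite -(eqp_dvdr _ qE) dvdp_map.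
  have [m cm] := dvdp_prod_XsubC dvc.
  rewrite cycE rmorphB /= map_polyXn rmorph1 in cm.
  have /hasP[z _ z_prim] := prim_root_split (prime_gt1 l_pr) l0E cm.
  exists <<1; z>>%AS; last by move=> _; exists z => //; apply: memv_adjoin.
  (* [z] is a root of [1 + 'X + .. + 'X^(l-1)], so its degree is positive and less than [l]. *)
  rewrite dim_Fadjoin dimv1 muln1 gtnNdvd //.
  rewrite -ltnS -size_minPoly ltnS; pose S : {poly E} := \sum_(i < l) 'X^i.
  have XS : 'X^l - 1 = ('X - 1) * S by rewrite subrX1.
  have S0 : S != 0.
    apply: contraTneq isT => S0; move: (monic_neq0 (monicXnsubC (1 : E) l_gt0)).
    by rewrite polyC1 XS S0 mulr0 eqxx.
  have Sz : root S z.
    have := prim_expr_order z_prim; move/(congr1 (fun t => t - 1)).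
    rewrite subrr subrX1 => /eqP; rewrite mulf_eq0 subr_eq0.
    case/orP=> [/eqP z1|/eqP Sz0].
      move: (prim_order_dvd z_prim 1); rewrite z1 expr1n eqxx dvdn1 => /eqP l1.
      by move: l_pr; rewrite l1.
    apply/rootP; rewrite -{}Sz0 /S horner_sum.
    by apply: eq_bigr => i _; rewrite hornerXn.
  have S1 : S \is a polyOver 1%AS.
    by apply: rpred_sum => i _; rewrite rpredX ?polyOverX.
  apply: leq_trans (dvdp_leq S0 (minPoly_dvdp S1 Sz)) _.
  rewrite (_ : S = \poly_(i < l) 1) ?size_poly // poly_def.
  by apply: eq_bigr => i _; rewrite scale1r.
have galk1 : galois k1 {:E} by apply: galoisS galE; rewrite sub1v subvf.
have l_gal : (l %| #|'Gal({:E} / k1)%g|)%N.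
  rewrite -(galois_dim galk1); move: l_dimE.
  by rewrite [X in (_ %| X)%N -> _](dim_sup_field (subvf k1)) Euclid_dvdM //
    (negPf l_dim) orbF.
have [x xgal ordx] := Cauchy l_pr l_gal.
pose k' := fixedField_aspace <[x]>%g.
have k1k' : (k1 <= k')%VS.
  by rewrite /= -galois_connection ?subvf // cycle_subG.
have sepk' : separable 1 k'.
  by case/and3P: galE => _ sep _; apply: separableSr sep; apply: subvf.
case: (boolP eps) => [eps1|eps0].
- have lE : l \in [pchar E] by rewrite (rmorph_pchar (in_alg E)).
  have [b bk nob] := artin_schreier_generator l_pr ordx lE.
  have := @obstruction_in_subfield k E k' (b ^+ l - b) l true sepk' l_pr.
  by move=> /(_ eps1 bk nob)[g [a ob]]; exists g, a, l, true.
- have [z zk1 z_prim] := k1z eps0.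
  have zk' := subvP k1k' _ zk1.
  have [b bk nob] := kummer_generator l_pr ordx z_prim zk'.
  have := @obstruction_in_subfield k E k' (b ^+ l) l false sepk' l_pr.
  rewrite (negPf eps0) in l_char => /(_ l_char bk).
  case=> [c ck|g [a ob]]; first by rewrite mulr0n subr0 nob.
  by exists g, a, l, false.
Qed.

(** * The formula *)

Section PolynomialTerms.

Variables (K : fieldType) (V : Type) (env : V -> K).

Notation ev := (eval (M := field_structure K) env).

(** Terms denote ring elements only, so a polynomial is coded by the list of terms for its
    coefficients, constant term first. *)
Definition poly_of_terms (s : seq (term V)) : {poly K} := Poly [seq ev c | c <-
  s].

Fixpoint terms_add (s t : seq (term V)) : seq (term V) :=
  match s, t with
  | [::], _ => t
  | _, [::] => s
  | a :: s', b :: t' => Add a b :: terms_add s' t'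
  end.

Fixpoint terms_mul (s t : seq (term V)) : seq (term V) :=
  if s is a :: s' then
    terms_add [seq Mul a b | b <- t] (Zero V :: terms_mul s' t)
  else [::].

Fixpoint terms_exp (s : seq (term V)) (n : nat) : seq (term V) :=
  if n is n'.+1 then terms_mul s (terms_exp s n') else [:: One V].

Definition terms_opp (s : seq (term V)) : seq (term V) := [seq Opp c | c <- s].

Fixpoint terms_eq0 (s : seq (term V)) : formula V :=
  if s is c :: s' then And (Eq c (Zero V)) (terms_eq0 s')
  else Eq (Zero V) (Zero V).

Lemma poly_of_cons c s :
  poly_of_terms (c :: s) = poly_of_terms s * 'X + (ev c)%:P.
Proof. by rewrite /poly_of_terms /= cons_poly_def. Qed.

Lemma poly_of_terms_add s t :
  poly_of_terms (terms_add s t) = poly_of_terms s + poly_of_terms t.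
Proof.
elim: s t => [|a s IHs] [|b t]; rewrite /= ?poly_of_cons.
- by rewrite add0r.
- by rewrite [poly_of_terms [::]]/poly_of_terms /= add0r.
- by rewrite [poly_of_terms [::]]/poly_of_terms /= addr0.
- by rewrite IHs /= polyCD; ring.
Qed.

Lemma poly_of_terms_mul s t :
  poly_of_terms (terms_mul s t) = poly_of_terms s * poly_of_terms t.
Proof.
elim: s => [|a s IHs] /=; first by rewrite /poly_of_terms /= mul0r.
rewrite poly_of_terms_add !poly_of_cons IHs /= addr0 mulrDl addrC.
congr (_ + _); first by ring.
elim: t {IHs} => [|b t IHt]; first by rewrite /poly_of_terms /= mulr0.
by rewrite /= !poly_of_cons IHt /= polyCM; ring.
Qed.

Lemma poly_of_terms_exp s n :
  poly_of_terms (terms_exp s n) = poly_of_terms s ^+ n.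
Proof.
elim: n => [|n IHn] /=; last by rewrite poly_of_terms_mul IHn exprS.
by rewrite poly_of_cons /poly_of_terms /= mul0r add0r.
Qed.

Lemma poly_of_terms_opp s : poly_of_terms (terms_opp s) = - poly_of_terms s.
Proof.
elim: s => [|c s IHs]; first by rewrite /poly_of_terms /= oppr0.
by rewrite /= !poly_of_cons IHs /= polyCN; ring.
Qed.

Lemma satisfies_terms_eq0 s :
  satisfies (M := field_structure K) env (terms_eq0 s) <-> poly_of_terms s = 0.
Proof.
elim: s => [|c s IHs] //=; rewrite IHs poly_of_cons; split=> [[-> ->]|eq0].
  by rewrite mul0r add0r.
have c0 : ev c = 0.
  have := congr1 (fun p : {poly K} => p`_0) eq0.
  by rewrite coefD coefMX coefC coef0 /= add0r.
split=> //; move: eq0; rewrite c0 addr0 => /eqP.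
by rewrite mulf_eq0 polyX_eq0 orbF => /eqP.
Qed.

End PolynomialTerms.

(** The variables below [n] quantifiers. As [option] is applied on the inside, index [0] belongs to
    the outermost quantifier. *)
Fixpoint bound_vars (V : Type) (n : nat) : Type :=
  if n is n'.+1 then bound_vars (option V) n' else V.

Fixpoint exists_many (V : Type) (n : nat) : formula (bound_vars V n) -> formula
  V :=
  match n return formula (bound_vars V n) -> formula V with
  | 0 => id
  | n'.+1 => fun f => Exists (@exists_many (option V) n' f)
  end.

Fixpoint free_var (V : Type) (n : nat) : V -> bound_vars V n :=
  match n return V -> bound_vars V n with
  | 0 => id
  | n'.+1 => fun v => @free_var (option V) n' (Some v)
  end.

Fixpoint new_var (V : Type) (n i : nat) : term (bound_vars V n) :=
  match n return term (bound_vars V n) with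
  | 0 => Zero V
  | n'.+1 => if i is i'.+1 then new_var (option V) n' i'
             else Var (@free_var (option V) n' None)
  end.

Fixpoint extend_many (M : ring_structure) (V : Type) (n : nat) (env : V -> M)
    (a : nat -> M) : bound_vars V n -> M :=
  match n return bound_vars V n -> M with
  | 0 => env
  | n'.+1 => extend_many (n := n') (extend env (a 0)) (fun i => a i.+1)
  end.

Section ManyQuantifiers.

Variable M : ring_structure.

Lemma satisfies_exists_many (V : Type) (n : nat) (env : V -> M)
    (f : formula (bound_vars V n)) :
  satisfies env (exists_many f)
  <-> exists a : nat -> M, satisfies (extend_many env a) f.
Proof.
elim: n V env f => [|n IHn] V env f /=.
  by split=> [sf|[_ //]]; exists (fun=> rs_zero M).
split=> [[a0 /IHn[a sf]]|[a sf]].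
  by exists (fun i => if i is i'.+1 then a i' else a0).
by exists (a 0); apply/IHn; exists (fun i => a i.+1).
Qed.

Lemma extend_many_free (V : Type) (n : nat) (env : V -> M) (a : nat -> M) (v :
  V) :
  extend_many env a (free_var n v) = env v.
Proof. by elim: n V env a v => //= n IHn V env a v; rewrite IHn. Qed.

Lemma eval_new_var (V : Type) (n i : nat) (env : V -> M) (a : nat -> M) :
  (i < n)%N -> eval (extend_many env a) (new_var V n i) = a i.
Proof.
elim: n i V env a => // n IHn [|i] V env a ltin /=; last by rewrite IHn.
by rewrite extend_many_free.
Qed.

End ManyQuantifiers.

Lemma poly_of_mkseq (K : fieldType) (V : Type) (env : V -> K) (N : nat)
    (f : nat -> term V) (b : nat -> K) :
    (forall i, (i < N)%N -> eval (M := field_structure K) env (f i) = b i) ->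
  poly_of_terms env [seq f i | i <- iota 0 N] = \poly_(i < N) b i.
Proof.
move=> fb; apply/polyP=> i; rewrite /poly_of_terms coef_Poly coef_poly
  -map_comp.
have [ltiN|leNi] := ltnP i N; last by rewrite nth_default // size_map size_iota.
by rewrite (nth_map 0%N) ?size_iota // nth_iota // add0n /= fb.
Qed.

Section CoverFormula.

Variables (n D l : nat) (eps : bool).
Hypothesis l_gt0 : (0 < l)%N.

(* The tuple [x] lists the shift [t] followed by the [D + 1] coefficients of
   [g]; the formula bounds the [D] coefficients of a polynomial [h] and those of
   the quotient by [g]. *)
Let V : Type := block_var (fun _ : 'I_n => 1%N) D.+2.
Let Q := (D + (D * l).+2)%N.

Let xvar (i : nat) : term (bound_vars V Q) :=
  Var (free_var Q (inr (inord i) : V)).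
Let yvar (j : 'I_n) : term (bound_vars V Q) :=
  Var (free_var Q (inl (existT (fun _ : 'I_n => 'I_1) j ord0) : V)).

Let h_terms := [seq new_var V Q i | i <- iota 0 D].
Let q_terms := [seq new_var V Q (D + i) | i <- iota 0 (D * l).+2].
Let g_terms := [seq xvar i.+1 | i <- iota 0 D.+1].
Let c_term := Add (xvar 0) (foldr (fun j => Mul (yvar j)) (One _) (enum 'I_n)).

Definition cover_formula : formula V := exists_many (terms_eq0
  (terms_add (terms_mul [:: c_term; One _]
      (terms_add (terms_exp h_terms l)
         (if eps then terms_opp h_terms else [::])))
    (terms_opp (terms_add [:: One _] (terms_mul q_terms g_terms))))).

Lemma satisfies_cover_formula (K : fieldType) (g : {poly K})
    (y : 'I_n -> 'I_1 -> K) (x : 'I_D.+2 -> K) :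
    size g = D.+1 -> (forall i : 'I_D.+1, x (inord i.+1) = g`_i) ->
  satisfies (M := field_structure K) (block_assign y x) cover_formula
  <-> exists h : {poly K}, (size h < size g)%N /\
        g %| ('X + (x ord0 + \prod_(j < n) y j ord0)%:P) * (h ^+ l - h *+ eps)
          - 1.
Proof.
move=> szg xg; set c := x ord0 + _.
have g0 : g != 0 by rewrite -size_poly_eq0 szg.
have l1 := l_gt0.
rewrite /cover_formula satisfies_exists_many.
pose ph (a : nat -> K) := \poly_(i < D) a i.
pose pq (a : nat -> K) := \poly_(i < (D * l).+2) a (D + i)%N.
have sat_iff (a : nat -> K) :
    satisfies (M := field_structure K) (extend_many (block_assign y x : V ->
      field_structure K) a)
      (terms_eq0 (terms_add (terms_mul [:: c_term; One _]
        (terms_add (terms_exp h_terms l)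
           (if eps then terms_opp h_terms else [::])))
        (terms_opp (terms_add [:: One _] (terms_mul q_terms g_terms)))))
    <-> ('X + c%:P) * (ph a ^+ l - ph a *+ eps) - 1 = pq a * g.
  rewrite satisfies_terms_eq0; set env := extend_many _ _.
  have -> : poly_of_terms env (terms_add (terms_mul [:: c_term; One _]
        (terms_add (terms_exp h_terms l)
           (if eps then terms_opp h_terms else [::])))
        (terms_opp (terms_add [:: One _] (terms_mul q_terms g_terms))))
      = ('X + c%:P) * (ph a ^+ l - ph a *+ eps) - (1 + pq a * g).
    have hE : poly_of_terms env h_terms = ph a.
      apply: poly_of_mkseq => i ltiD.
      by apply: eval_new_var; rewrite ltn_addr.
    have qE : poly_of_terms env q_terms = pq a.
      apply: poly_of_mkseq => i ltiD.
      by apply: eval_new_var; rewrite ltn_add2l.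
    have gE : poly_of_terms env g_terms = g.
      rewrite (poly_of_mkseq (b := fun i => g`_i)) => [|i ltiD].
        by rewrite -szg coefK.
      by rewrite /= /env extend_many_free /= (xg (Ordinal ltiD)).
    have cE : eval (M := field_structure K) env c_term = c.
      rewrite /= /env extend_many_free /=; congr (x _ + _).
        by apply: val_inj; rewrite /= inordK.
      rewrite -big_enum; elim: (enum _) => [|j s IHs]; first by rewrite big_nil.
      by rewrite big_cons /= /env extend_many_free IHs.
    clearbody h_terms q_terms g_terms c_term.
    rewrite poly_of_terms_add poly_of_terms_mul poly_of_terms_opp.
    rewrite !poly_of_terms_add poly_of_terms_exp poly_of_terms_mul hE qE gE.
    rewrite !poly_of_cons cE [poly_of_terms _ [::]]/poly_of_terms /= mul0r
      add0r mul1r.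
    congr (_ * _ - _).
    by case: (eps); rewrite ?poly_of_terms_opp ?hE ?mulr1n // /poly_of_terms /=
      mulr0n subr0 addr0.
  by rewrite opprD addrA; split=> [/eqP|->]; rewrite ?subrr // subr_eq0 => /eqP.
split=> [[a /sat_iff eqa]|[h [szh /dvdpP[q qE]]]].
  exists (ph a); rewrite szg ltnS size_poly; split=> //.
  by rewrite eqa dvdp_mull.
exists (fun i => if (i < D)%N then h`_i else q`_(i - D)).
apply/sat_iff.
have -> : ph (fun i => if (i < D)%N then h`_i else q`_(i - D)) = h.
  apply/polyP => i; rewrite coef_poly; case: ltnP => // leDi.
  by rewrite nth_default // -ltnS (leq_trans szh) // szg.
rewrite qE; congr (_ * g); apply/polyP => i; rewrite coef_poly.
rewrite [(D + i < D)%N]ltnNge leq_addr /= addKn; case: ltnP => // lei.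
rewrite nth_default //; apply: leq_trans lei.
have szqg : (size q <= size (q * g)%R)%N.
  have [->|q0] := eqVneq q 0; first by rewrite size_poly0.
  by rewrite size_mul // szg addnS leq_addr.
(* Origin of the bound [(D * l).+2]: [h ^+ l] has size at most [(D * l).+1], and the factor of
   degree one adds one more. *)
apply: (leq_trans szqg); rewrite -qE (leq_trans (size_polyD _ _)) //.
rewrite size_polyN size_poly1 geq_max andbT.
rewrite (leq_trans (size_polyMleq _ _)) // size_XaddC /= add1n ltnS.
have szhD : (size h <= D)%N by rewrite -ltnS -szg.
rewrite (leq_trans (size_polyD _ _)) // geq_max size_polyN; apply/andP; split.
  rewrite (leq_trans (size_poly_exp_leq _ _)) // ltnS leq_mul //.
  exact: leq_trans (leq_pred _) szhD.
apply: (@leq_trans D); last by rewrite leqW // leq_pmulr.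
by case: (eps); rewrite ?size_poly0.
Qed.

End CoverFormula.

(** * The independence property *)

Lemma digits_lt (R n : nat) (f : nat -> nat) :
  (forall j, (f j < R)%N) -> (\sum_(j < n) f j * R ^ j < R ^ n)%N.
Proof.
move=> fR; elim: n => [|n IHn]; first by rewrite big_ord0 expn0.
rewrite big_ord_recr /= -addSn expnS.
apply: (@leq_trans ((f n).+1 * R ^ n)); first by rewrite mulSn leq_add2r.
by rewrite leq_mul2r fR orbT.
Qed.

Lemma digits_inj (R n : nat) (f f' : nat -> nat) :
    (forall j, (f j < R)%N) -> (forall j, (f' j < R)%N) ->
    (\sum_(j < n) f j * R ^ j = \sum_(j < n) f' j * R ^ j)%N ->
  forall j, (j < n)%N -> f j = f' j.
Proof.
move=> fR f'R; elim: n => [//|n IHn]; rewrite !big_ord_recr /= => eqs.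
have R0 : (0 < R ^ n)%N by rewrite expn_gt0 (leq_ltn_trans _ (fR 0)).
have eqn : f n = f' n.
  have := congr1 (fun m => m %/ R ^ n)%N eqs.
  by rewrite !divnDMl // !divn_small ?digits_lt.
move=> j; rewrite ltnS leq_eqVlt => /orP[/eqP -> //|ltjn].
by apply: IHn => //; move: eqs; rewrite eqn => /addIn.
Qed.

Theorem theorem7p3 (K : fieldType) (S : {pred K}) (k : subFieldType S)
    (k_pac : pseudo_algebraically_closed k)
    (k_nsc : ~ separably_closed k)
    (k_rac : relatively_algebraically_closed k)
    (n : nat) (n_gt0 : (0 < n)%N) :
  IP n (complete_theory (field_structure K)).
Proof.
pose iota : {rmorphism k -> K} := \val.
have rac x : algebraicOver iota x -> exists y, x = iota y.
  by move=> /k_rac xS; exists (Sub x xS); rewrite /iota /= SubK.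
have [g [a [l [eps [g_monic g_irr g_sep l_pr [l_char no_root]]]]]] :=
  cyclic_obstruction_exists k_nsc.
pose D := (size g).-1.
have size_g : size g = D.+1.
  by rewrite prednK // size_poly_gt0 monic_neq0.
exists (fun=> 1%N), D.+2, (cover_formula n D l eps); apply: formula_IP_finite
  => N.
(* With base [N.+1] the default digit [0] stays below the base even for [N = 0]. *)
pose R := N.+1; pose M := (R ^ n)%N.
have [eta shift] := generic_shifts M (pac_infinite k_pac) (monic_neq0 g_monic).
pose digit (i : {ffun 'I_n -> nat}) (j : nat) : nat := oapp i 0%N (insub j).
pose code (i : {ffun 'I_n -> nat}) := (\sum_(j < n) digit i j * R ^ j)%N.
have digitE i (j : 'I_n) : digit i j = i j by rewrite /digit valK.
have digitR (i : {ffun 'I_n -> nat}) : (forall j, (i j < N)%N) ->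
    forall j, (digit i j < R)%N.
  by move=> iN j; rewrite /digit; case: insubP => //= j' _ _; rewrite ltnS ltnW.
(* The trace of [I] on the box, read as a Boolean pattern on codes; a code determines its tuple by
   uniqueness of the digits. *)
pose J (I : {ffun 'I_n -> nat} -> Prop) (c : nat) : bool :=
  excluded_middle_informative
    (exists i : {ffun 'I_n -> nat}, [/\ forall j, (i j < N)%N, code i = c & I
      i]).
have ex_t I : exists t, forall j, (j < M)%N ->
    cover_solvable iota g l eps (iota (t + eta ^+ j)) <-> J I j.
  exact: (cover_pattern (e := fun j => eta ^+ j) k_pac rac g_monic g_irr g_sep
    l_pr l_char no_root).
pose t I := sval (constructive_indefinite_description _ (ex_t I)).
have tP I := svalP (constructive_indefinite_description _ (ex_t I)).
exists (fun j v _ => iota (eta ^+ (v * R ^ j))).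
exists (fun I c => if c == ord0 then iota (t I) else iota g`_c.-1).
move=> I i iN; have ltcM : (code i < M)%N by apply/digits_lt/digitR.
rewrite (@satisfies_cover_formula n D l eps (prime_gt0 l_pr) K (map_poly iota
  g)).
- rewrite eqxx -rmorph_prod -rmorphD.
  have -> : \prod_(j < n) eta ^+ (i j * R ^ j) = eta ^+ code i.
    rewrite /code; under [in RHS]eq_bigr do rewrite digitE.
    by rewrite (big_morph _ (exprD eta) (expr0 eta)).
  rewrite -[X in X <-> _]/(cover_solvable iota g l eps (iota (t I + eta ^+ code
    i))).
  rewrite tP // /J; case: excluded_middle_informative => /= [ex|nex]; last
    first.
    by split=> // Ii; case: nex; exists i.
  split=> // _; have [i' [i'N codeE Ii']] := ex.
  suff -> : i = i' by [].
  apply/ffunP => j; rewrite -!digitE; apply: (digits_inj (n := n)) => //.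
  + exact: digitR.
  + exact: digitR.
  + exact: esym codeE.
- by rewrite size_map_poly.
- by move=> c; rewrite (coef_map iota) -val_eqE /= inordK // ltnS ltn_ord.
Qed.
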